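(* Let $q\in(1,2]$ and let $\mathcal{G}:L^q(\Omega)\to[0,\infty]$ be the generative prior (defined in the context), where $Z:\Theta\to\mathbb{R}^{N_c}$ is linear and bounded and the functionals $\mathcal{J}_l:M^l\to[0,\infty]$ are weak* lower semicontinuous with $\mathcal{J}_l(0)=0$. Then for any $v\in L^q(\Omega)$ with $\mathcal{G}(v)<\infty$, the infimum in the definition of $\mathcal{G}(v)$ is attained, i.e. there exists $(\mu,\theta)\in F(v)$ such that $\mathcal{G}(v)=G(\mu,\theta)$.
   Context: Domains and measures. $\Omega,\Sigma\subset\mathbb{R}^d$ are bounded domains, i.e. bounded, open and simply connected sets, with $0\in\Sigma$. For sets, $A-B=\{x-y: x\in A,\ y\in B\}$. Put $\Omega^0=\Omega$, $\Omega^1=\Omega-\Sigma$ and $\Omega^{l+1}=\Omega^l-\Sigma$. For $\omega\subset\mathbb{R}^d$, $C_0(\omega)$ is the closure of $C_c(\omega)$ in the uniform norm, and $(\mathcal{M}(\omega),\|\cdot\|_{\mathcal M})$ is its dual space (finite Radon measures with the total variation norm). For bounded $\omega$, a function $f\in L^q(\omega)$ is identified with the element $\phi\mapsto\int_\omega f\phi\,dx$ of $\mathcal{M}(\omega)$; $\|\cdot\|_2$ is the $L^2$-norm. Convolution. For $l\ge1$, $\mu\in\mathcal{M}(\Omega^l)$ and $g\in L^2(\Sigma)$, $\mu*g$ denotes the unique function, belonging to $L^q(\Omega^{l-1})$ for every $q\in(1,2]$, with $\int_{\Omega^{l-1}}(\mu*g)\phi\,dx=\int_{\Omega^l}\int_\Sigma\tilde\phi(x+y)g(x)\,dx\,d\mu(y)$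 for all $\phi\in C_c(\Omega^{l-1})$, where $\tilde\phi$ is the extension of $\phi$ by zero to $\mathbb{R}^d$. (It is known that such a function exists and that $\|\mu*g\|_q\le C\|\mu\|_{\mathcal M}\|g\|_2$ with a constant $C$ independent of $\mu,g$.) Network. Let $L\in\mathbb{N}$ be the number of layers, $N_1,\dots,N_L\in\mathbb{N}$ and $N_0=1$. For $l=1,\dots,L$ let $E^l\subset\{1,\dots,N_l\}\times\{1,\dots,N_{l-1}\}$ be such that for each $n\in\{1,\dots,N_l\}$ there is some $k$ with $(n,k)\in E^l$. Set $M^l=\mathcal{M}(\Omega^l)^{N_l}$, $M=M^1\times\dots\times M^L$, $\Theta^l=L^2(\Sigma)^{|E^l|}$ with elements $\theta^l=(\theta^l_{n,k})_{(n,k)\in E^l}$, and $\Theta=\Theta^1\times\dots\times\Theta^L$. Define $\mu^1*_1\theta^1=\sum_{n=1}^{N_1}\mu^1_n*\theta^1_{n,1}\in L^q(\Omega)$ and, for $l=2,\dots,L$, $\mu^l*_l\theta^l=\big(\sum_{n:(n,k)\in E^l}\mu^l_n*\theta^l_{n,k}\big)_{k=1}^{N_{l-1}}\in M^{l-1}$. Generative prior. With $Z$ ($N_c\in\mathbb{N}$) and $\mathcal{J}_l$, $l=1,\dots,L-1$, as in the claim, put $\|\mu\|_{\mathcal M}=\sum_{l=1}^L\sum_{n=1}^{N_l}\|\mu^l_n\|_{\mathcal M}$ and $G(\mu,\theta)=\|\mu\|_{\mathcal M}+\sum_{l=2}^L\mathcal{J}_{l-1}(\mu^{l-1}-\mu^l*_l\theta^l)$.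 For $v\in L^q(\Omega)$ let $F(v)$ be the set of all $(\mu,\theta)\in M\times\Theta$ with $v=\mu^1*_1\theta^1$, $\|\theta^l_{n,k}\|_2\le1$ for all $l$ and all $(n,k)\in E^l$, and $Z\theta=0$. Then $\mathcal{G}(v)=\inf_{(\mu,\theta)\in F(v)}G(\mu,\theta)$, with $\mathcal{G}(v)=\infty$ if $F(v)=\emptyset$. *)

(* Defs.v *)
From HB Require Import structures.
From mathcomp Require Import all_boot all_order all_algebra.
From mathcomp Require Import all_classical all_reals all_analysis.
From mathcomp Require Import measurable_realfun ring.
Set Implicit Arguments. Unset Strict Implicit. Unset Printing Implicit Defensive.
Import Order.TTheory GRing.Theory Num.Theory.
Import numFieldNormedType.Exports.
Local Open Scope classical_set_scope.
Local Open Scope ring_scope.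

(* 'rV[R]_n is equipped with its Borel sigma-algebra. *)
Fact borel_display : measure_display. Proof. exact: default_measure_display. Qed.

Section borel_rV.
Context {R : realType} {n : nat}.
Let borel : set (set 'rV[R]_n) := <<s open >>.
Let borel0 : borel set0. Proof. exact: sigma_algebra0. Qed.
Let borelC A : borel A -> borel (~` A). Proof. exact: sigma_algebraC. Qed.
Let borelU (F : (set 'rV[R]_n)^nat) :
  (forall i, borel (F i)) -> borel (\bigcup_i F i).
Proof. exact: sigma_algebra_bigcup. Qed.
HB.instance Definition _ := @isMeasurable.Build borel_display 'rV[R]_n borel
  borel0 borelC borelU.
End borel_rV.

Lemma measurable_rVE (R : realType) (n : nat) :
  @measurable _ 'rV[R]_n = <<s open >>.
Proof. by []. Qed.

Section lebesgue_rV.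
Context (R : realType).
Local Notation mR := (measurableTypeR R).

Definition row_of_tuple n (t : n.-tuple mR) : 'rV[R]_n := \row_i tnth t i.

Let qbox n (p : 'rV[rat]_n * nat) : set 'rV[R]_n :=
  [set v | forall i, `|v ord0 i - ratr (p.1 ord0 i)| < p.2.+1%:R^-1].

Let open_qboxes n (U : set 'rV[R]_n) : open U ->
  U = \bigcup_(p in [set p | @qbox n p `<=` U]) qbox p.
Proof.
move=> oU; apply/seteqP; split=> [v Uv|v [p /= pU pv]]; last exact: pU.
have /nbhs_ballP[e /= e0 eU] : nbhs v U by apply: open_nbhs_nbhs.
have [k ke] : exists k, k.+1%:R^-1 < e / 2.
  have e20 : 0 < e / 2 by rewrite divr_gt0.
  by have [k /=] := ltr_add_invr e20; rewrite add0r => h; exists k.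
have k0 : 0 < k.+1%:R^-1 :> R by rewrite invr_gt0.
have H i : exists q : rat, `|v ord0 i - ratr q| < k.+1%:R^-1.
  have [|q] := @rat_in_itvoo R (v ord0 i - k.+1%:R^-1) (v ord0 i + k.+1%:R^-1).
    by rewrite ltrBlDr -addrA ltrDl addr_gt0.
  by rewrite in_itv/= => /andP[h1 h2]; exists q; rewrite ltr_norml ltrBrDr addrC ltrBlDr h2/= ltrBlDl -ltrBlDr h1.
exists (\row_i projT1 (cid (H i)), k) => [w /= wb|i /=]; last first.
  by rewrite mxE; case: cid.
apply: eU => /=; split => // i j; rewrite ord1.
have := wb j; rewrite !mxE; case: cid => q /= vq wq.
rewrite /ball/= (_ : v _ _ - _ = (v ord0 j - ratr q) + - (w ord0 j - ratr q)).
  apply: le_lt_trans (ler_normD _ _) _; rewrite normrN [ltRHS]splitr.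
  by rewrite ltrD// (lt_trans _ ke).
by rewrite opprB addrA subrK.
Qed.

Let mrow n : measurable_fun [set: n.-tuple mR] (@row_of_tuple n).
Proof.
apply: (measurability _ (@measurable_rVE R n)).
move=> _ [U oU <-]; rewrite setTI (open_qboxes oU) preimage_bigcup bigcup_mkcond.
apply: countable_bigcupT_measurable; first exact: countableP.
move=> -[q k]; case: ifPn => // _.
rewrite (_ : _ @^-1` _ = \bigcap_(i in [set: 'I_n])
    ((fun t : n.-tuple mR => tnth t i) @^-1` ball (ratr (q ord0 i) : R) k.+1%:R^-1)).
  apply: fin_bigcap_measurable => // i _; rewrite -[X in measurable X]setTI.
  by apply: measurable_tnth => //; exact: measurable_ball.
apply/seteqP; split => t /= h i; first by have := h i; rewrite mxE distrC.
by have := h i Logic.I; rewrite /ball/= mxE distrC.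
Qed.

HB.instance Definition _ n := isMeasurableFun.Build _ _ _ _ (@row_of_tuple n) (@mrow n).

Definition tuple_cons n (p : mR * n.-tuple mR) : n.+1.-tuple mR :=
  [the n.+1.-tuple mR of p.1 :: p.2].

Let mcons n : measurable_fun setT (@tuple_cons n).
Proof. exact: measurable_cons. Qed.

HB.instance Definition _ n := isMeasurableFun.Build _ _ _ _ (@tuple_cons n) (@mcons n).

Section lebesgue_cons.
Variables (n : nat) (m : {sigma_finite_measure set (n.-tuple mR) -> \bar R}).

Definition lebesgue_cons : set (n.+1.-tuple mR) -> \bar R :=
  pushforward (@lebesgue_measure R \x m)%E (@tuple_cons n).

Let step0 : lebesgue_cons set0 = 0%E.
Proof. exact: measure0. Qed.

Let step_ge0 A : (0 <= lebesgue_cons A)%E.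
Proof. exact: measure_ge0. Qed.

Let step_sigma_additive : semi_sigma_additive lebesgue_cons.
Proof. exact: measure_semi_sigma_additive. Qed.

HB.instance Definition _ := isMeasure.Build _ _ _ lebesgue_cons
  step0 step_ge0 step_sigma_additive.

Let step_sigma_finite : sigma_finite setT lebesgue_cons.
Proof.
have /sigma_finiteP[F [FT ndF Foo]] := sigma_finiteT (@lebesgue_measure R).
have /sigma_finiteP[G [GT ndG Goo]] := sigma_finiteT m.
pose g (t : n.+1.-tuple mR) : mR * n.-tuple mR := (thead t, [tuple of behead t]).
have gK : cancel (@tuple_cons n) g.
  by case=> x t; congr pair; exact/val_inj.
have mg : measurable_fun setT g.
  apply: measurable_fun_pair; first exact: measurable_tnth.
  exact: measurable_behead.
exists (fun i => g @^-1` (F i `*` G i)) => [|i].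
  rewrite -preimage_bigcup (_ : \bigcup_i _ = setT) ?preimage_setT//.
  apply/seteqP; split=> // -[x t] _.
  have [[k _ Fk] [l _ Gl]] : (\bigcup_i F i) x /\ (\bigcup_i G i) t.
    by rewrite -FT -GT.
  exists (maxn k l) => //; split.
  - by move: x Fk; exact/subsetPset/ndF/leq_maxl.
  - by move: t Gl; exact/subsetPset/ndG/leq_maxr.
have [[mF Fi] [mG Gi]] := (Foo i, Goo i); split.
  by rewrite -[X in measurable X]setTI; apply: mg => //; exact: measurableX.
rewrite /lebesgue_cons /pushforward -comp_preimage (_ : g \o _ = id); last first.
  by apply/funext => p; exact: gK.
by rewrite preimage_id product_measure1E// lte_mul_pinfty// ge0_fin_numE.
Qed.

HB.instance Definition _ := Measure_isSigmaFinite.Build _ _ _ lebesgue_cons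
  step_sigma_finite.
End lebesgue_cons.

Fixpoint lebesgue_tuple n : {sigma_finite_measure set (n.-tuple mR) -> \bar R} :=
  if n is m.+1 then lebesgue_cons (lebesgue_tuple m) else \d_ [tuple].

Definition lebesgue_rV n : set 'rV[R]_n -> \bar R :=
  pushforward (lebesgue_tuple n) (@row_of_tuple n).

Section lebesgue_rV_measure.
Variable n : nat.
Let rV0 : @lebesgue_rV n set0 = 0%E.
Proof. exact: measure0. Qed.

Let rV_ge0 A : (0 <= @lebesgue_rV n A)%E.
Proof. exact: measure_ge0. Qed.

Let rV_sigma_additive : semi_sigma_additive (@lebesgue_rV n).
Proof. exact: measure_semi_sigma_additive. Qed.

HB.instance Definition _ := isMeasure.Build _ _ _ (@lebesgue_rV n)
  rV0 rV_ge0 rV_sigma_additive.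
End lebesgue_rV_measure.

Let measurable_tuple_box n (A : 'I_n -> set mR) :
  (forall i, measurable (A i)) ->
  measurable [set t : n.-tuple mR | forall i, A i (tnth t i)].
Proof.
move=> mA; rewrite (_ : mkset _ =
    \bigcap_(i in [set: 'I_n]) ((fun t : n.-tuple mR => tnth t i) @^-1` A i)).
  apply: fin_bigcap_measurable => // i _; rewrite -[X in measurable X]setTI.
  exact: measurable_tnth.
by apply/seteqP; split => [t /= h i _|t h i]; [exact: h|exact: (h i Logic.I)].
Qed.

Let lebesgue_tuple_box n (A : 'I_n -> set mR) :
  (forall i, measurable (A i)) ->
  lebesgue_tuple n [set t | forall i, A i (tnth t i)] =
  (\prod_(i < n) lebesgue_measure (A i))%E.
Proof.
elim: n A => [A _|n IH A mA].
  by rewrite big_ord0 /= diracE mem_set// => -[].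
rewrite big_ord_recl -IH//= -product_measure1E//; last first.
  exact: (@measurable_tuple_box _ (fun i => A (lift ord0 i)) (fun i => mA _)).
rewrite -[LHS]/((lebesgue_measure \x lebesgue_tuple n)%E
  (@tuple_cons n @^-1` [set t | forall i, A i (tnth t i)])).
suff -> : @tuple_cons n @^-1` [set t | forall i, A i (tnth t i)] =
  A ord0 `*` [set t | forall i, A (lift ord0 i) (tnth t i)] by [].
apply/seteqP; split => [[x t] /= h|[x t] [/= Ax At] i].
  split; first by have := h ord0; rewrite tnth0.
  by move=> i; have := h (lift ord0 i); rewrite tnthS.
by case: (unliftP ord0 i) => [j ->|->]; rewrite ?tnthS ?tnth0.
Qed.

Lemma lebesgue_rV_box n (A : 'I_n -> set R) : (forall i, measurable (A i)) ->
  lebesgue_rV [set v : 'rV[R]_n | forall i, A i (v ord0 i)] =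
  (\prod_(i < n) lebesgue_measure (A i))%E.
Proof.
move=> mA; rewrite -lebesgue_tuple_box// /lebesgue_rV /pushforward.
by congr (_ _); apply/seteqP; split => t /= h i; have := h i; rewrite mxE.
Qed.

End lebesgue_rV.

Lemma open_measurable_rV (R : realType) n (U : set 'rV[R]_n) :
  open U -> measurable U.
Proof. by move=> oU; rewrite measurable_rVE; exact: sub_sigma_algebra. Qed.

Lemma continuous_measurable_rV (R : realType) n (f : 'rV[R]_n -> R) :
  continuous f -> measurable_fun setT f.
Proof.
move=> /continuousP cf; apply: (measurability _ (RGenOpens.measurableE R)).
move=> _ [_ [a [b ->] <-]]; rewrite setTI; apply: open_measurable_rV.
exact/cf/interval_open.
Qed.

Lemma approx_continuous (R : realType) (T : topologicalType) (f : T -> R) :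
  (forall e : R, 0 < e -> exists2 g : T -> R, continuous g &
    forall x, `|f x - g x| <= e) -> continuous f.
Proof.
move=> f0 x; apply/cvgrPdist_le => e e0.
have e3 : 0 < e / 3 by rewrite divr_gt0.
have [g cg fg] := f0 _ e3.
have := cg x; move/cvgrPdist_le => /(_ _ e3).
apply: filterS => y gxy.
have -> : f x - f y = (f x - g x) + (g x - g y) - (f y - g y) by ring.
rewrite (le_trans (ler_normB _ _))//.
have -> : e = e / 3 + e / 3 + e / 3 by field.
by rewrite lerD// (le_trans (ler_normD _ _))// lerD.
Qed.

(* For an open w, a function on w vanishing at the boundary is represented by
   its extension by zero to the whole space, so that C_c w and C_0 w are sets
   of functions on 'rV_d. *)
Section function_spaces.
Context {R : realType} {d : nat}.
Local Notation V := 'rV[R]_d.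
Local Notation leb := (@lebesgue_rV R d).
Implicit Types (w : set V) (f : V -> R).

Definition C_c w : set (V -> R) := [set f | continuous f /\
  compact (closure [set x | f x != 0]) /\ closure [set x | f x != 0] `<=` w].

Definition C_0 w : set (V -> R) := [set f |
  forall e : R, 0 < e -> exists2 g, C_c w g & forall x, `|f x - g x| <= e].

Let C0pred w : {pred V -> R} := mem (C_0 w).

Lemma C_cP w f : continuous f -> (exists K, [/\ compact K, K `<=` w &
  forall x, f x != 0 -> K x]) -> C_c w f.
Proof.
move=> cf [K [cK Kw fK]].
have cl : closure [set x | f x != 0] `<=` K.
  have clK : closed K by exact: compact_closed.
  by rewrite [X in _ `<=` X](_ : K = closure K); [exact: closure_subset|exact/closure_id].
split=> //; split; last exact: subset_trans Kw.
exact: (subclosed_compact (@closed_closure _ _) cK cl).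
Qed.

Lemma C_c_submod w a f g : C_c w f -> C_c w g -> C_c w (a *: f + g).
Proof.
move=> [cf [Kf fw]] [cg [Kg gw]]; apply: C_cP.
  move=> x; apply: (@continuousD _ _ _ (fun x => a * f x : R^o) g x); last exact: cg.
  apply: (@continuousM _ _ (fun=> a) f x); [exact: cst_continuous|exact: cf].
exists (closure [set x | f x != 0] `|` closure [set x | g x != 0]); split.
- exact: compactU.
- by rewrite subUset; split.
- move=> x; have [fx0|fx0 _] := eqVneq (f x) (0 : R); last by left; exact: subset_closure.
  have [gx0|gx0 _] := eqVneq (g x) (0 : R); last by right; exact: subset_closure.
  have -> : (a *: f + g) x = a * f x + g x :> R by [].
  by rewrite fx0 gx0 mulr0 add0r eqxx.
Qed.

Lemma C_c0 w : C_c w 0.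
Proof.
apply: C_cP; first by move=> x; exact: cst_continuous.
by exists set0; split => //; [exact: compact0|move=> x /=; rewrite eqxx].
Qed.

Lemma C_c_C_0 w : C_c w `<=` C_0 w.
Proof. by move=> f cf e e0; exists f => // x; rewrite subrr normr0 ltW. Qed.

Let C_0_submod w : submod_closed (C0pred w).
Proof.
split; first by apply/mem_set/C_c_C_0/C_c0.
move=> a f g /set_mem f0 /set_mem g0; apply/mem_set => e e0.
have na0 : 0 < `|a| + 1 by rewrite ltr_wpDl.
have e2 : 0 < e / 2 by rewrite divr_gt0.
have [p pw pf] := f0 (e / 2 / (`|a| + 1)) (divr_gt0 e2 na0).
have [q qw qg] := g0 (e / 2) e2.
exists (a *: p + q); first exact: C_c_submod.
move=> x; have -> : (a *: f + g) x - (a *: p + q) x =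
  (a * f x + g x) - (a * p x + q x) :> R by [].
rewrite opprD addrACA -mulrBr (le_trans (ler_normD _ _))// [leRHS]splitr lerD//.
rewrite normrM (@le_trans _ _ ((`|a| + 1) * (e / 2 / (`|a| + 1))))//.
  by rewrite ler_pM// lerDl.
by rewrite mulrC divfK// gt_eqF.
Qed.

HB.instance Definition _ w :=
  GRing.isSubmodClosed.Build R (V -> R) (C0pred w) (C_0_submod w).

Definition C0 w : Type := {f : V -> R | f \in C0pred w}.
HB.instance Definition _ w := [isSub of C0 w for @sval _ _].
HB.instance Definition _ w := [Choice of C0 w by <:].
HB.instance Definition _ w := [SubChoice_isSubLmodule of C0 w by <:].

Definition C0_fun w (f : C0 w) : V -> R := val f.
Coercion C0_fun : C0 >-> Funclass.


Lemma C0_continuous w (f : C0 w) : continuous (C0_fun f).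
Proof.
apply: approx_continuous => e e0; have /set_mem/(_ _ e0) := valP f.
by move=> [g [cg _] fg]; exists g.
Qed.

Lemma C0_bounded w (f : C0 w) : has_ubound (range (fun x => `|C0_fun f x|)).
Proof.
have /set_mem /(_ 1 ltr01)[g [cg [Kg _]] fg] := valP f.
have /compact_bounded[M [Mr Mg]] : compact (g @` closure [set x | g x != 0]).
  apply: continuous_compact Kg.
  by apply: continuous_subspaceT.
exists (`|M| + 1 + 1) => _ [x _ <-].
rewrite -[C0_fun f x](subrK (g x)) (le_trans (ler_normD _ _))// addrC lerD//.
have [->|gx0] := eqVneq (g x) (0 : R); first by rewrite normr0 addr_ge0.
apply: Mg; first by rewrite (le_lt_trans (ler_norm _))// ltrDl.
by exists x => //; exact: subset_closure.
exact: fg.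
Qed.

Definition supnorm w (f : C0 w) : R := sup (range (fun x => `|C0_fun f x|)).

Lemma le_supnorm w (f : C0 w) x : `|C0_fun f x| <= supnorm f.
Proof. by apply: ub_le_sup; [exact: C0_bounded|exists x]. Qed.

Lemma supnorm_le w (f : C0 w) (M : R) :
  (forall x, `|C0_fun f x| <= M) -> supnorm f <= M.
Proof.
move=> fM; apply: ge_sup => [|_ [x _ <-] //].
by exists `|C0_fun f 0|, 0.
Qed.

Let supnormD w (f g : C0 w) : supnorm (f + g) <= supnorm f + supnorm g.
Proof.
apply: supnorm_le => x; rewrite (le_trans (ler_normD (C0_fun f x) (C0_fun g x)))//.
by rewrite lerD// le_supnorm.
Qed.

Let supnormZ w (a : R) (f : C0 w) : supnorm (a *: f) = `|a| * supnorm f.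
Proof.
apply/le_anti/andP; split.
  apply: supnorm_le => x; have -> : C0_fun (a *: f) x = a * C0_fun f x by [].
  by rewrite normrM ler_wpM2l// le_supnorm.
have [->|a0] := eqVneq a 0.
  by rewrite normr0 mul0r (le_trans _ (le_supnorm _ 0)).
rewrite mulrC -ler_pdivlMr ?normr_gt0//; apply: supnorm_le => x.
rewrite ler_pdivlMr ?normr_gt0// mulrC -normrM.
by rewrite -[a * _]/(C0_fun (a *: f) x) le_supnorm.
Qed.

Let supnorm_eq0 w (f : C0 w) : supnorm f = 0 -> f = 0.
Proof.
move=> f0; apply/val_inj/funext => x; apply/eqP.
by rewrite -normr_le0 -f0; exact: le_supnorm.
Qed.

HB.instance Definition _ w :=
  Lmodule_isNormed.Build R (C0 w) (@supnormD w) (@supnormZ w) (@supnorm_eq0 w).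

(* radon w is the dual of C_0(w), i.e. the space of finite Radon measures on w;
   tvnorm is the dual norm, i.e. the total variation norm. *)
Let radon_set w : set (C0 w -> R) :=
  [set L : C0 w -> R | scalar L /\ continuous L].

Let radon_pred w : {pred C0 w -> R} := mem (@radon_set w).

Let radon_submod w : submod_closed (@radon_pred w).
Proof.
split.
  apply/mem_set; split; last by move=> x; exact: cst_continuous.
  by move=> a x y; rewrite /= mulr0 addr0.
move=> a L M /set_mem[lL cL] /set_mem[lM cM]; apply/mem_set; split.
  move=> b x y.
  have E z : (a *: L + M) z = a * L z + M z :> R by [].
  by rewrite !E lL lM; ring.
move=> x; apply: (@continuousD _ _ _ (fun x => a * L x : R^o) M x); last exact: cM.
by apply: (@continuousM _ _ (fun=> a) L x); [exact: cst_continuous|exact: cL].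
Qed.

HB.instance Definition _ w :=
  GRing.isSubmodClosed.Build R (C0 w -> R) (@radon_pred w) (@radon_submod w).

Definition radon w : Type := {L : C0 w -> R | L \in @radon_pred w}.
HB.instance Definition _ w := [isSub of radon w for @sval _ _].
HB.instance Definition _ w := [Choice of radon w by <:].
HB.instance Definition _ w := [SubChoice_isSubLmodule of radon w by <:].

Definition radon_fun w (mu : radon w) : C0 w -> R := val mu.
Coercion radon_fun : radon >-> Funclass.

Definition tvnorm w (mu : radon w) : \bar R :=
  ereal_sup [set `|mu f|%:E | f in [set f | `|f| <= 1]].

End function_spaces.

Section densities.
Context {R : realType} {d : nat}.
Local Notation V := 'rV[R]_d.
Local Notation leb := (@lebesgue_rV R d).

(* A function f in L^1(w) as an element of the dual of C_0(w). The default value 0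
   of insubd is only used when phi |-> \int_w f phi is not continuous and linear,
   which is excluded by radon_densityE for integrable f. *)
Definition radon_density (w : set V) (f : V -> R) : radon w :=
  insubd (0 : radon w)
    (fun phi : C0 w => \int[leb]_(x in w) (f x * phi x)).

Lemma radon_densityE (w : set V) (f : V -> R) (phi : C0 w) :
  measurable w -> leb.-integrable w (EFin \o f) ->
  radon_density w f phi = \int[leb]_(x in w) (f x * phi x).
Proof.
move=> mw intf; set L := fun phi : C0 w => \int[leb]_(x in w) (f x * phi x).
have mphi (psi : C0 w) : measurable_fun w psi.
  by apply: measurable_funTS; apply: continuous_measurable_rV; exact: C0_continuous.
have int (psi : C0 w) : leb.-integrable w (EFin \o (fun x => f x * psi x)).
  have -> : EFin \o (fun x => f x * psi x) = ((EFin \o f) \* (EFin \o psi))%E.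
    by [].
  apply: integrableMl => //.
  exists (supnorm psi); split; first exact: num_real.
  by move=> M sM x _; rewrite /= (le_trans (le_supnorm _ _))// ltW.
have linL a (p q : C0 w) : L (a *: p + q) = a * L p + L q.
  rewrite /L.
  have -> : (fun x => f x * C0_fun (a *: p + q) x) =
      (fun x => a * (f x * p x) + f x * q x).
    apply/funext => x; have -> : C0_fun (a *: p + q) x = a * p x + q x :> R by [].
    by rewrite mulrDr mulrCA.
  rewrite RintegralD//; last first.
    exact: (integrableZl mw a (int p)).
  by rewrite RintegralZl.
pose C := \int[leb]_(x in w) `|f x|.
have LC psi : `|L psi| <= C * `|psi|.
  have intn : leb.-integrable w (EFin \o (fun x => `|f x|)).
    exact: (integrable_norm intf).
  rewrite (le_trans (le_normr_Rintegral mw (int psi)))//.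
  rewrite /C -RintegralZr//; apply: le_Rintegral => //.
  - exact: (integrable_norm (int psi)).
  - exact: (integrableZr mw `|psi| intn).
  - by move=> x _; rewrite normrM ler_wpM2l//; exact: le_supnorm.
have cL : continuous L.
  pose L' : C0 w -> R^o := L.
  pose aL := GRing.isLinear.Build R (C0 w) R^o *%R L' linL.
  pose lL : {linear C0 w -> R^o} := HB.pack L' aL.
  apply: (@bounded_linear_continuous R (C0 w) R^o lL).
  apply/linear_boundedP; exists C; split; first exact: num_real.
  by move=> r Cr psi; rewrite (le_trans (LC psi))// ler_wpM2r// ltW.
rewrite /radon_density /radon_fun val_insubd ifT//.
by apply/mem_set; split.
Qed.

End densities.

Section spaces.
Context {R : realType} {d : nat}.
Local Notation V := 'rV[R]_d.
Local Notation leb := (@lebesgue_rV R d).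
Implicit Types (w : set V).

(* L^p(w): representatives are extended by zero outside w and identified
   up to null sets, so equalities in L^p(w) are stated almost everywhere. *)
Definition Lp w (p : \bar R) : set (V -> R) :=
  [set f | f \in Lfun leb p /\ forall x, ~ w x -> f x = 0].

Let L2pred w : {pred V -> R} := mem (Lp w 2%:E).

Let L2_submod w : submod_closed (L2pred w).
Proof.
have [H0 Hc] := @Lfun_submod_closed _ _ R leb 2%:E (lee1n 2).
split; first by apply/mem_set.
move=> a f g /set_mem[f2 fw] /set_mem[g2 gw]; apply/mem_set; split.
  exact: Hc.
move=> x wx; have -> : (a *: f + g) x = a * f x + g x :> R by [].
by rewrite fw// gw// mulr0 add0r.
Qed.

HB.instance Definition _ w :=
  GRing.isSubmodClosed.Build R (V -> R) (L2pred w) (L2_submod w).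

Definition L2 w : Type := {f : V -> R | f \in L2pred w}.
HB.instance Definition _ w := [isSub of L2 w for @sval _ _].
HB.instance Definition _ w := [Choice of L2 w by <:].
HB.instance Definition _ w := [SubChoice_isSubLmodule of L2 w by <:].

Definition L2_fun w (g : L2 w) : V -> R := val g.
Coercion L2_fun : L2 >-> Funclass.

Definition L2norm w (g : L2 w) : \bar R := 'N[leb]_2%:E [EFin \o g].

Definition minkowski_sub (A B : set V) : set V := [set x - y | x in A & y in B].

(* h represents mu * g. The function phi is already extended by zero; the inner
   integral, as a function of y, is a continuous function which vanishes outside
   w - s, hence (w being open and bounded) an element psi of C_0(w - s), at which
   the functional mu is evaluated. *)
Definition is_conv (w s : set V) (mu : radon (minkowski_sub w s)) (g : L2 s)
    (h : V -> R) : Prop :=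
  (forall q : R, 1 < q <= 2 -> Lp w q%:E h) /\
  forall phi, C_c w phi ->
    exists2 psi : C0 (minkowski_sub w s),
      (forall y, psi y = \int[leb]_(x in s) (phi (x + y) * g x)) &
      \int[leb]_(x in w) (h x * phi x) = mu psi.

(* A representative of mu * g, which is unique up to null sets. *)
Definition conv w s (mu : radon (minkowski_sub w s)) (g : L2 s) : V -> R :=
  get (is_conv mu g).

End spaces.

Definition path_connected {T : topologicalType} (R : realType) (A : set T) :=
  forall x y, A x -> A y -> exists c : R -> T,
    [/\ {within `[0, 1], continuous c}, c @` `[0, 1] `<=` A, c 0 = x & c 1 = y].

Definition simply_connected {T : topologicalType} (R : realType) (A : set T) :=
  path_connected R A /\
  forall c : R -> T, {within `[0, 1], continuous c} -> c @` `[0, 1] `<=` A ->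
    c 0 = c 1 ->
    exists H : R * R -> T,
      [/\ {within `[0, 1] `*` `[0, 1], continuous H},
          H @` (`[0, 1] `*` `[0, 1]) `<=` A,
          (forall t, t \in `[0, 1] -> H (0, t) = c t /\ H (1, t) = c 0) &
          forall s, s \in `[0, 1] -> H (s, 0) = c 0 /\ H (s, 1) = c 0].

Definition bounded_domain {R : realType} {d : nat} (A : set 'rV[R]_d) :=
  [/\ bounded_set A, open A & simply_connected R A].

(* N_0 = 1; N 0 is irrelevant. *)
Definition width (N : nat -> nat) (l : nat) : nat := if l is _.+1 then N l else 1.

(* The network has L = K.+1 layers; layer l, 1 <= l <= L, is indexed by
   i = l - 1 : 'I_K.+1, so E i is the set E^(i+1) of connections between the
   nodes of layer i.+1 and the nodes of layer i. *)
Section network.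
Context {R : realType} {d : nat}.
Local Notation V := 'rV[R]_d.
Local Notation leb := (@lebesgue_rV R d).
Variables (Omega Sigma : set V).

Fixpoint layer_domain (l : nat) : set V :=
  if l is k.+1 then minkowski_sub (layer_domain k) Sigma else Omega.

Variables (K : nat) (N : nat -> nat).
Variable E : forall i : 'I_K.+1, {set 'I_(width N i.+1) * 'I_(width N i)}.

Definition measures (l : nat) : Type :=
  'I_(width N l) -> radon (layer_domain l).

(* The weak-* topology on the dual of C_0^N is the coarsest one making all the
   evaluations at elements of C_0 continuous, in each of the N components. *)
Definition weak_star_eval l (m : measures l) :
    {ptws 'I_(width N l) * C0 (layer_domain l) -> R} :=
  fun p => m p.1 p.2.

Definition weak_star_lsc l (J : measures l -> \bar R) :=
  lower_semicontinuous (J : initial_topology (@weak_star_eval l) -> \bar R).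

Definition all_measures : Type := forall i : 'I_K.+1, measures i.+1.

Definition edge : Type :=
  {i : 'I_K.+1 & {e : 'I_(width N i.+1) * 'I_(width N i) | e \in E i}}.

Definition weights : Type := edge -> L2 Sigma.

(* The k-th component of mu^l *_l theta^l, for l = i.+1. *)
Definition layer_conv (i : 'I_K.+1) (m : measures i.+1) (theta : weights)
    (k : 'I_(width N i)) : V -> R :=
  \sum_(e : {e : 'I_(width N i.+1) * 'I_(width N i) | e \in E i} | (val e).2 == k)
     @conv R d (layer_domain i) Sigma (m (val e).1) (theta (existT _ i e)).

(* The functional G. With l = j.+2, J j is J_(l-1), the ordinal widen_ord j
   denotes layer l-1 and lift ord0 j denotes layer l. *)
Definition objective (J : forall j : 'I_K, measures j.+1 -> \bar R)
    (mu : all_measures) (theta : weights) : \bar R :=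
  (\sum_(i < K.+1) \sum_(n < width N i.+1) tvnorm (mu i n) +
   \sum_(j < K) J j (fun k => (mu (widen_ord (leqnSn K) j) k -
     radon_density (layer_domain j.+1)
       (layer_conv (mu (lift ord0 j)) theta k))%R))%E.

Definition feasible Nc (Z : weights -> 'rV[R]_Nc) (v : V -> R) :
    set (all_measures * weights) :=
  [set p : all_measures * weights | [/\ {ae leb, forall x, Omega x ->
                  v x = layer_conv (p.1 ord0) p.2 (@ord0 0) x},
               (forall e, (L2norm (p.2 e) <= 1)%E) &
               Z p.2 = 0] ].

Definition generative_prior J Nc (Z : weights -> 'rV[R]_Nc) (v : V -> R) :=
  ereal_inf [set objective J p.1 p.2 | p in feasible Z v].

End network.

(* Main.v *)
Require Import Defs.
From HB Require Import structures.
From mathcomp Require Import all_boot all_order all_algebra.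
From mathcomp Require Import all_classical all_reals all_analysis.
From mathcomp Require Import measurable_realfun ring lra.
Set Implicit Arguments. Unset Strict Implicit. Unset Printing Implicit Defensive.
Import Order.TTheory GRing.Theory Num.Theory.
Import numFieldNormedType.Exports.
Local Open Scope classical_set_scope.
Local Open Scope ring_scope.

(** The infimum is attained by the direct method of the calculus of variations.

    Along a minimising sequence the measures have bounded total variation and
    the kernels lie in unit balls of [L2 Sigma].  All limits are taken along one
    ultrafilter on [nat] that contains the tails: bounded real sequences
    converge along it, so pointwise limits of functionals define a weak-star
    limit of the measures ([weak_star_compactness]) and, through the Riesz
    representation [riesz_along] in the complete space of weights, a weak limit
    of the kernels ([weak_compactness]).

    It must be shown that the limit is feasible and that the objective does not
    increase.  The convolution [mu * g] tested against [phi] is [mu] evaluated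
    at the correlation of [phi] with [g] ([conv_pairing]), and this expression
    is bilinear in two quantities that converge only weakly.  It passes to the
    limit ([conv_cvg]) because correlation with a fixed [phi] is a compact
    operator: weak convergence of the kernels gives pointwise convergence of
    equicontinuous functions that vanish outside a bounded set, hence uniform
    convergence ([corr_cvg_uniform]).  Therefore the residuals entering the
    functionals [J] converge weak-star, where lower semicontinuity applies; the
    total variation is a supremum of evaluations, so it is lower semicontinuous
    too.  The image constraint is a family of equations against test functions,
    by the fundamental lemma of the calculus of variations
    ([fundamental_lemma]); the norm constraints are weakly closed, and the
    bounded linear constraint [Z] is weakly continuous.

    The convolution is a chosen representative, so its existence has to be
    established first.  Translation invariance of Lebesgue measure and the
    Cauchy-Schwarz inequality bound the correlation uniformly by the product of
    the [L2] norms ([corr_le]); evaluating [mu] at it is thus a functional of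
    [phi] which is bounded for the [L2] norm, and [riesz_along] represents it by
    a square-integrable density ([conv_density]). *)

(** * Semi-inner products: Riesz representation and weak compactness *)

Section hilbert.
Context {R : realType}.

(** Only semidefinite: elements of [L2] are functions, so the norm of a function
    that vanishes almost everywhere is zero. *)
Definition semi_inner (H : lmodType R) (ip : H -> H -> R) : Prop :=
  [/\ forall x y, ip x y = ip y x,
      forall a x y z, ip (a *: x + y) z = a * ip x z + ip y z &
      forall x, 0 <= ip x x].

Definition ip_complete (H : lmodType R) (ip : H -> H -> R) : Prop :=
  forall f : nat -> H,
    (forall e, 0 < e -> exists n0, forall m n, (n0 <= m)%N -> (n0 <= n)%N ->
       ip (f m - f n) (f m - f n) <= e) ->
    exists h, forall e, 0 < e -> exists n0, forall n, (n0 <= n)%N ->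
       ip (f n - h) (f n - h) <= e.

Section one_space.
Variables (H : lmodType R) (ip : H -> H -> R) (ipP : semi_inner ip).

Lemma ipC x y : ip x y = ip y x. Proof. by case: ipP. Qed.
Lemma ip_ge0 x : 0 <= ip x x. Proof. by case: ipP. Qed.
Lemma ipDl x y z : ip (x + y) z = ip x z + ip y z.
Proof. by case: ipP => _ L _; have := L 1 x y z; rewrite scale1r mul1r. Qed.
Lemma ip0l z : ip 0 z = 0.
Proof. by apply: (@addrI _ (ip 0 z)); rewrite -ipDl !addr0. Qed.
Lemma ipZl a x z : ip (a *: x) z = a * ip x z.
Proof. by case: ipP => _ L _; have := L a x 0 z; rewrite addr0 ip0l addr0. Qed.
Lemma ipNl x z : ip (- x) z = - ip x z.
Proof. by rewrite -scaleN1r ipZl mulN1r. Qed.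
Lemma ipBl x y z : ip (x - y) z = ip x z - ip y z.
Proof. by rewrite ipDl ipNl. Qed.
Lemma ipDr x y z : ip z (x + y) = ip z x + ip z y.
Proof. by rewrite !(ipC z) ipDl. Qed.
Lemma ipZr a x z : ip z (a *: x) = a * ip z x.
Proof. by rewrite !(ipC z) ipZl. Qed.
Lemma ipBr x y z : ip z (x - y) = ip z x - ip z y.
Proof. by rewrite !(ipC z) ipBl. Qed.

Definition ipnorm x := Num.sqrt (ip x x).

Lemma ipnorm_ge0 x : 0 <= ipnorm x. Proof. exact: sqrtr_ge0. Qed.
Lemma ipnorm_sq x : ipnorm x ^+ 2 = ip x x.
Proof. by rewrite sqr_sqrtr// ip_ge0. Qed.

(** The discriminant argument.  It yields both the Cauchy-Schwarz inequality and
    the estimate of the first variation at an almost minimiser. *)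
Lemma quadratic_discr (c b s : R) : 0 <= s ->
  (forall a, 0 <= c + 2 * a * b + a ^+ 2 * s) -> b ^+ 2 <= c * s.
Proof.
move=> s0 h; have [s_eq0|sn0] := eqVneq s 0.
  have [->|bn0] := eqVneq b 0; first by rewrite s_eq0 expr0n/= mulr0.
  have := h (- (c + 1) / (2 * b)); rewrite s_eq0 mulr0 addr0.
  have -> : c + 2 * (- (c + 1) / (2 * b)) * b = -1 by field.
  by rewrite lerNr oppr0 ler10.
have s_gt0 : 0 < s by rewrite lt_neqAle eq_sym sn0.
have := h (- b / s).
have -> : c + 2 * (- b / s) * b + (- b / s) ^+ 2 * s = (c * s - b ^+ 2) / s.
  by field.
by rewrite pmulr_lge0 ?invr_gt0// subr_ge0.
Qed.

Lemma ip_cauchy_schwarz x y : `|ip x y| <= ipnorm x * ipnorm y.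
Proof.
rewrite -sqrtrM ?ip_ge0// -[X in X <= _]sqrtr_sqr ler_sqrt ?mulr_ge0 ?ip_ge0//.
apply: quadratic_discr => [|a]; first exact: ip_ge0.
have := ip_ge0 (x + a *: y).
rewrite ipDl !ipDr !ipZl !ipZr (ipC y x).
by congr (_ <= _); ring.
Qed.

(** The parallelogram law makes a minimising sequence of
    [t |-> |j t|^2 - 2 l t] a Cauchy sequence; the first variation at its limit
    is the representation.  Working with a map [j] instead of a subspace lets
    the functional live on a space of test functions that is not complete. *)
Lemma riesz_along (T : lmodType R) (j : T -> H) (l : T -> R) (C : R) :
  ip_complete ip ->
  (forall a t u, j (a *: t + u) = a *: j t + j u) ->
  (forall a t u, l (a *: t + u) = a * l t + l u) ->
  (forall t, `|l t| <= C * ipnorm (j t)) ->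
  exists h, forall t, l t = ip h (j t).
Proof.
move=> Hc jL lL lC.
pose I t := ip (j t) (j t) - 2 * l t.
have IE t u a : I (t + a *: u) =
    I t + 2 * a * (ip (j t) (j u) - l u) + a ^+ 2 * ip (j u) (j u).
  rewrite /I [t + _]addrC jL lL !ipDl !ipDr !ipZl !ipZr (ipC (j u) (j t)).
  by ring.
have Ilb t : - C ^+ 2 <= I t.
  rewrite /I -ipnorm_sq; have := lC t; rewrite ler_norml => /andP[_ h].
  have := sqr_ge0 (ipnorm (j t) - C); rewrite sqrrB; nra.
pose S := range I.
have Slb : has_inf S.
  by split; [exists (I 0), 0|exists (- C ^+ 2) => _ [t _ <-]].
have Iinf t : inf S <= I t by apply: inf_lbound; [case: Slb|exists t].
have tn n : exists t, I t <= inf S + n.+1%:R^-1.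
  have n0 : 0 < n.+1%:R^-1 :> R by rewrite invr_gt0.
  by have [_ [t _ <-] /ltW h] := inf_adherent n0 Slb; exists t.
pose t_ n := projT1 (cid (tn n)).
have tP n : I (t_ n) <= inf S + n.+1%:R^-1 by rewrite /t_; case: cid.
have par t u : ip (j t - j u) (j t - j u) <= 2 * (I t - inf S) + 2 * (I u - inf S).
  have := Iinf (t + 2^-1 *: (u - t)); rewrite IE.
  have -> : u - t = (-1) *: t + u by rewrite scaleN1r addrC.
  rewrite jL lL !ipBl !ipBr !ipDr !ipDl !ipZl !ipZr.
  rewrite (ipC (j u) (j t)) /I; lra.
have [h hP] : exists h, forall e, 0 < e -> exists n0, forall n, (n0 <= n)%N ->
    ip (j (t_ n) - h) (j (t_ n) - h) <= e.
  apply: Hc => e e0.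
  have e4 : 0 < e / 4 by rewrite divr_gt0.
  have [k ke] : exists k, k.+1%:R^-1 < e / 4.
    by have [k] := ltr_add_invr e4; rewrite add0r => ?; exists k.
  exists k => m n km kn; rewrite (le_trans (par _ _))//.
  have K i : (k <= i)%N -> I (t_ i) - inf S <= e / 4.
    move=> ki; rewrite lerBlDl (le_trans (tP i))// lerD2l (le_trans _ (ltW ke))//.
    by rewrite lef_pV2 ?posrE// ler_nat.
  by have := K _ km; have := K _ kn; lra.
exists h => s; apply/eqP; rewrite eq_sym -subr_eq0 -normr_le0.
apply/ler_addgt0Pl => e e0; rewrite addr0.
(* [M] exceeds [|j s|], so that the two errors below, each of which is
   [e / (2 M) * |j s|], add up to at most [e]. *)
pose M := ipnorm (j s) + 1.
have M0 : 0 < M by rewrite ltr_wpDl// ipnorm_ge0.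
have eM : 0 < (e / (2 * M)) ^+ 2 by rewrite exprn_gt0// divr_gt0// mulr_gt0.
have [n0 hn] := hP _ eM.
have [k ke] : exists k, k.+1%:R^-1 < (e / (2 * M)) ^+ 2.
  by have [k] := ltr_add_invr eM; rewrite add0r => ?; exists k.
pose n := maxn n0 k.
have sq (x y : R) : 0 <= y -> x ^+ 2 <= y ^+ 2 -> `|x| <= y.
  move=> y0 xy; rewrite -(ger0_norm y0) -(@ler_pXn2r _ 2) ?nnegrE//.
  by rewrite !real_normK ?num_real.
have A : `|ip (j (t_ n)) (j s) - l s| <= e / (2 * M) * ipnorm (j s).
  apply: sq; first by rewrite mulr_ge0 ?ipnorm_ge0// divr_ge0 ?ltW// mulr_gt0.
  rewrite exprMn ipnorm_sq (@le_trans _ _ (n.+1%:R^-1 * ip (j s) (j s)))//.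
    apply: quadratic_discr => [|a]; first exact: ip_ge0.
    rewrite -(lerD2l (inf S)) addr0 (le_trans (Iinf (t_ n + a *: s)))// IE.
    by rewrite !addrA !lerD2r; exact: tP.
  rewrite ler_wpM2r ?ip_ge0// (le_trans _ (ltW ke))// lef_pV2 ?posrE// ler_nat ltnS.
  exact: leq_maxr.
have B : `|ip (j (t_ n) - h) (j s)| <= e / (2 * M) * ipnorm (j s).
  rewrite (le_trans (ip_cauchy_schwarz _ _))// ler_wpM2r ?ipnorm_ge0//.
  have e0' : 0 <= e / (2 * M) by rewrite divr_ge0 ?ltW// mulr_gt0.
  rewrite -(ger0_norm e0') -sqrtr_sqr ler_sqrt ?sqr_ge0//.
  exact/hn/leq_maxl.
have -> : ip h (j s) - l s = (ip (j (t_ n)) (j s) - l s) - ip (j (t_ n) - h) (j s).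
  by rewrite ipBl; ring.
rewrite (le_trans (ler_normB _ _))// (le_trans (lerD A B))//.
have -> : e / (2 * M) * ipnorm (j s) + e / (2 * M) * ipnorm (j s) = e * (ipnorm (j s) / M).
  by field; rewrite gt_eqF.
by rewrite ler_piMr ?(ltW e0)// ler_pdivrMr// mul1r lerDl.
Qed.

End one_space.

(** Bounded reals have a limit along an ultrafilter: this replaces the
    extraction of subsequences. *)
Lemma ultra_bounded_cvg (I : Type) (U : set_system I) (f : I -> R) (B : R) :
  UltraFilter U -> (\forall i \near U, `|f i| <= B) -> exists l : R, f @ U --> l.
Proof.
move=> UU fB.
have UfU : UltraFilter (f @ U).
  split; first exact: fmap_proper_filter.
  move=> G PG UG; apply/seteqP; split=> // A GA.
  have [//|UnA] := in_ultra_setVsetC (f @^-1` A) UU.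
  have GnA : G (~` A) by apply: UG.
  have : G (A `&` ~` A) by exact: filterI.
  by rewrite setICr => /filter_not_empty.
have := @segment_compact R (- B) B; rewrite compact_ultra => /(_ _ UfU)[].
  by apply: filterS fB => i; rewrite /= in_itv/= ler_norml.
by move=> l [_ lP]; exists l.
Qed.

(** A default value when there is no limit, which [ulimP] excludes for
    eventually bounded [f]. *)
Definition ulim (I : Type) (U : set_system I) (f : I -> R) : R :=
  get [set l : R | f @ U --> l].

Lemma ulimP (I : Type) (U : set_system I) (f : I -> R) (B : R) :
  UltraFilter U -> (\forall i \near U, `|f i| <= B) -> f @ U --> ulim U f.
Proof.
move=> UU /(ultra_bounded_cvg UU)[l fl].
by apply: (@getPex _ [set l : R | f @ U --> l]); exists l.
Qed.

Lemma ulim_unique (I : Type) (U : set_system I) (f : I -> R) (l : R) :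
  UltraFilter U -> f @ U --> l -> ulim U f = l.
Proof.
move=> UU fl; have gl : f @ U --> ulim U f.
  by apply: (@getPex _ [set l : R | f @ U --> l]); exists l.
exact: cvg_unique gl fl.
Qed.

(** The limits of the inner products form a bounded functional, and its
    representative is the weak limit. *)
Lemma weak_compactness (H : lmodType R) (ip : H -> H -> R) (I : Type)
    (U : set_system I) (x : I -> H) (B : R) :
  semi_inner ip -> ip_complete ip -> UltraFilter U ->
  (\forall i \near U, ipnorm ip (x i) <= B) ->
  exists y, forall z, ip (x i) z @[i --> U] --> ip y z.
Proof.
move=> ipP Hc UU xB.
have [i0 iB] := filter_ex xB.
have B0 : 0 <= B by rewrite (le_trans _ iB)// ipnorm_ge0.
have bnd z : \forall i \near U, `|ip (x i) z| <= B * ipnorm ip z.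
  apply: filterS xB => i iB'; rewrite (le_trans (ip_cauchy_schwarz ipP _ _))//.
  by rewrite ler_wpM2r// ipnorm_ge0.
pose l z := ulim U (fun i => ip (x i) z).
have lP z : ip (x i) z @[i --> U] --> l z by apply: ulimP (bnd z).
have lL a t u : l (a *: t + u) = a * l t + l u.
  apply: ulim_unique; under eq_fun do rewrite (ipDr ipP) (ipZr ipP).
  by apply: cvgD (lP u); apply: cvgM (lP t); exact: cvg_cst.
have lC z : `|l z| <= B * ipnorm ip z.
  by apply: cvgr_to_le (bnd z); apply: cvg_norm; exact: lP.
have [y yP] := riesz_along ipP (j := id) Hc (fun _ _ _ => erefl) lL lC.
by exists y => z; rewrite -yP.
Qed.

End hilbert.
(** * Completeness of the space of square-integrable functions *)

Section square_integrable.
Context {dT : measure_display} {T : measurableType dT} {R : realType}.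
Variable mu : {measure set T -> \bar R}.
Implicit Types f g : T -> R.

Lemma Lfun_measurable (p : \bar R) f : f \in Lfun mu p -> measurable_fun setT f.
Proof. by rewrite inE => /andP[/[!inE]/=]. Qed.

Lemma Lfun2P f : f \in Lfun mu 2%:E <->
  measurable_fun setT f /\ (\int[mu]_x (f x ^+ 2)%:E < +oo)%E.
Proof.
split=> [f2|[mf foo]].
  split; first exact: Lfun_measurable f2.
  have /integrableP[_] := Lfun2_integrable_sqr f2.
  by under eq_integral do rewrite gee0_abs ?lee_fin ?sqr_ge0//.
rewrite inE; apply/andP; split; rewrite inE//= /finite_norm unlock poweR_lty//.
apply: le_lt_trans foo.
by under eq_integral => x _ do rewrite /= powR_mulrn// real_normK ?num_real//.
Qed.

Lemma Lfun2B f g : f \in Lfun mu 2%:E -> g \in Lfun mu 2%:E ->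
  (fun x => f x - g x) \in Lfun mu 2%:E.
Proof.
move=> f2 g2; have [_ H] := @Lfun_submod_closed _ _ R mu 2%:E (lee1n 2).
rewrite (_ : (fun x => _) = -1 *: g + f); first exact: H.
apply/funext => x; have -> : (-1 *: g + f) x = -1 * g x + f x :> R by [].
by rewrite mulN1r addrC.
Qed.

(** Weighting the squared increments of a fast subsequence by [4 ^ k] keeps
    their sum integrable; wherever this sum is finite, the increments are
    dominated by a geometric sequence, so the subsequence converges there. *)
Lemma fast_cvg_ae (g : nat -> T -> R) :
  (forall n, measurable_fun setT (g n)) ->
  (forall k, \int[mu]_x ((g k.+1 x - g k x) ^+ 2)%:E <=
      ((4 ^+ k)^-1 * (2 ^ k.+1)%:R^-1)%:E)%E ->
  exists A : set T, [/\ measurable A, mu (~` A) = 0 &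
    forall x, A x -> cvgn (g^~ x)].
Proof.
move=> mg gk.
pose D k x := 4 ^+ k * (g k.+1 x - g k x) ^+ 2.
have D0 k x : 0 <= D k x by rewrite mulr_ge0 ?sqr_ge0 ?exprn_ge0.
have mD k : measurable_fun setT (EFin \o D k).
  apply/measurable_EFinP; apply: measurable_funM => //.
  by apply: measurable_funX; exact: measurable_funB.
pose S x := (\sum_(k <oo) (D k x)%:E)%E.
have S0 x : (0 <= S x)%E by apply: nneseries_ge0 => k _ _; rewrite lee_fin.
have mS : measurable_fun setT S.
  by apply: ge0_emeasurable_sum => k; [move=> x _ _; rewrite lee_fin|move=> _; exact: mD].
have iS : (\int[mu]_x S x < +oo)%E.
  rewrite integral_nneseries//; last by move=> k x _; rewrite lee_fin.
  apply: (@le_lt_trans _ _ 1%E); last exact: ltry.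
  apply: le_trans (@epsilon_trick0 R 1 xpredT ler01).
  apply: lee_nneseries => [k _ _|k _].
    by apply: integral_ge0 => x _; rewrite lee_fin.
  rewrite /D; under eq_integral do rewrite EFinM.
  rewrite ge0_integralZl//; last 2 first.
  - by apply/measurable_EFinP; apply: measurable_funX; exact: measurable_funB.
  - by move=> x _; rewrite lee_fin sqr_ge0.
  rewrite (@le_trans _ _ ((4 ^+ k)%:E * ((4 ^+ k)^-1 * (2 ^ k.+1)%:R^-1)%:E)%E)//.
    by apply: lee_wpmul2l; [rewrite lee_fin exprn_ge0|exact: gk].
  by rewrite -EFinM lee_fin mulrA mulfV ?expf_neq0// div1r mul1r.
have /integrable_ae : mu.-integrable setT S.
  by apply/integrableP; split=> //; under eq_integral do rewrite gee0_abs//.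
move=> /(_ measurableT) aeS.
pose A := [set x | (S x < +oo)%E].
have mA : measurable A.
  by rewrite -[A]setTI; exact: emeasurable_fun_infty_o.
exists A; split=> //.
  apply: measure_negligible; first exact: measurableC.
  apply: negligibleS aeS => x /= nS; rewrite not_implyE; split => //.
  by move/fin_numPlt => /andP[_]; exact: nS.
move=> x Ax.
have Sfin : S x \is a fin_num by rewrite ge0_fin_numE.
pose s := fine (S x).
have s0 : 0 <= s by rewrite fine_ge0.
have Ds k : D k x <= s.
  rewrite -lee_fin fineK//.
  have := @nneseries_lim_ge _ (fun k => (D k x)%:E) xpredT 0%N k.+1
     (fun n _ _ => D0 n x).
  apply: le_trans; rewrite big_nat_recr//= leeDr//.
  by apply: sume_ge0 => i _; rewrite lee_fin.
have dk k : `|g k.+1 x - g k x| <= geometric (s + 1) 2^-1 k.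
  rewrite /= exprVn ler_pdivlMr ?exprn_gt0//.
  have := Ds k; rewrite /D.
  have -> : 4 ^+ k = (2 ^+ k) ^+ 2 :> R.
    by rewrite -exprM mulnC exprM; congr (_ ^+ _); rewrite -natrX.
  rewrite -exprMn => h.
  have p0 : 0 <= 2 ^+ k :> R by rewrite exprn_ge0.
  rewrite -(@ler_pXn2r _ 2) ?nnegrE ?mulr_ge0 ?addr_ge0//.
  rewrite -[X in _ * X]ger0_norm// -normrM real_normK ?num_real// mulrC.
  by rewrite (le_trans h)//; nra.
have : cvgn (series (telescope (g^~ x))).
  apply: (@normed_cvg R R^o).
  apply: (@series_le_cvg _ _ (geometric (s + 1) 2^-1)) => //.
  - by move=> n /=.
  - by move=> n; apply: geometric_ge0; rewrite ?addr_ge0 ?invr_ge0.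
  - by apply: is_cvg_geometric_series; rewrite ger0_norm ?invr_ge0// invf_lt1// ltr1n.
rewrite telescopeK => /cvg_ex[l ll]; apply/cvg_ex; exists (l + g 0 x).
have -> : g^~ x = (fun n => (g n x - g 0 x) + g 0 x) by apply/funext => n; rewrite subrK.
by apply: cvgD ll _; exact: cvg_cst.
Qed.

Lemma le_limn_einf (u : (\bar R)^nat) (e : \bar R) (n0 : nat) :
  (forall k, (n0 <= k)%N -> u k <= e)%E -> (limn_einf u <= e)%E.
Proof.
move=> ue; rewrite limn_einf_lim; apply: lime_le; first exact: is_cvg_einfs.
near=> n; apply: (@le_trans _ _ (u (maxn n0 n))).
  by apply: ereal_inf_lbound; exists (maxn n0 n) => //=; exact: leq_maxr.
exact/ue/leq_maxl.
Unshelve. all: by end_near. Qed.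

(** A common zero set [Z] of the sequence is kept by the limit, which is how
    functions supported in a given set form a complete subspace.  Multiplying
    by the indicator of the set of convergence makes the subsequence converge
    everywhere, hence to a measurable function, and Fatou's lemma bounds the
    distance to the limit. *)
Lemma Lfun2_complete (f : nat -> T -> R) (Z : set T) :
  (forall n, f n \in Lfun mu 2%:E) -> (forall n x, Z x -> f n x = 0) ->
  (forall e : R, 0 < e -> exists n0, forall m n, (n0 <= m)%N -> (n0 <= n)%N ->
     (\int[mu]_x ((f m x - f n x) ^+ 2)%:E <= e%:E)%E) ->
  exists h, [/\ h \in Lfun mu 2%:E, forall x, Z x -> h x = 0 &
    forall e : R, 0 < e -> exists n0, forall n, (n0 <= n)%N ->
     (\int[mu]_x ((f n x - h x) ^+ 2)%:E <= e%:E)%E].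
Proof.
move=> f2 fZ fC.
pose ep k : R := (4 ^+ k)^-1 * (2 ^ k.+1)%:R^-1.
have ep0 k : 0 < ep k by rewrite mulr_gt0 ?invr_gt0 ?exprn_gt0 ?ltr0n ?expn_gt0.
pose M k := projT1 (cid (fC _ (ep0 k))).
have MP k m n : (M k <= m)%N -> (M k <= n)%N ->
    (\int[mu]_x ((f m x - f n x) ^+ 2)%:E <= (ep k)%:E)%E.
  by rewrite /M; case: cid => /= n0; apply.
(* [idx k] and [idx k.+1] both lie beyond the Cauchy modulus [M k]. *)
pose idx k := (k + \max_(i < k.+1) M i)%N.
have Midx k : (M k <= idx k)%N.
  by rewrite /idx (leq_trans _ (leq_addl _ _))// (leq_bigmax_cond (@ord_max k)).
have idxS k : (M k <= idx k.+1)%N.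
  rewrite /idx (leq_trans _ (leq_addl _ _))//.
  have := @leq_bigmax_cond 'I_k.+2 xpredT (fun i => M i) (inord k) isT.
  by rewrite inordK.
pose g k := f (idx k).
have mf n : measurable_fun setT (f n) by exact: Lfun_measurable (f2 n).
have [A [mA A0 gA]] : exists A : set T, [/\ measurable A, mu (~` A) = 0 &
    forall x, A x -> cvgn (g^~ x)].
  by apply: fast_cvg_ae => [n|k]; [exact: mf|exact: MP].
pose g' k x := \1_A x * g k x.
pose h x := limn (g'^~ x).
have g'h x : g'^~ x @ \oo --> h x.
  have [Ax|nAx] := pselect (A x).
    have E : g'^~ x = g^~ x.
      by apply/funext => k; rewrite /g' indicE mem_set// mul1r.
    by rewrite /h E; exact: gA.
  apply/cvg_ex; exists 0.
  have -> : g'^~ x = cst 0 by apply/funext => k; rewrite /g' indicE memNset// mul0r.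
  exact: cvg_cst.
have mg' k : measurable_fun setT (g' k).
  by apply: measurable_funM; [exact: measurable_indic|exact: mf].
have mh : measurable_fun setT h.
  by apply: (measurable_fun_cvg mg') => x _; exact: g'h.
have hZ x : Z x -> h x = 0.
  move=> Zx; apply: (@cvg_lim R^o) => //.
  have -> : g'^~ x = cst 0 by apply/funext => k; rewrite /g' /g fZ// mulr0.
  exact: cvg_cst.
have hP : forall e : R, 0 < e -> exists n0, forall n, (n0 <= n)%N ->
     (\int[mu]_x ((f n x - h x) ^+ 2)%:E <= e%:E)%E.
  move=> e e0; have [n0 n0P] := fC _ e0; exists n0 => n nn.
  have -> : (fun x => ((f n x - h x) ^+ 2)%:E) =
      (fun x => limn_einf (fun k => ((f n x - g' k x) ^+ 2)%:E)).
    apply/funext => x; apply/esym.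
    have C : ((f n x - g' k x) ^+ 2)%:E @[k --> \oo] --> ((f n x - h x) ^+ 2)%:E.
      apply: cvg_EFin; first by near=> k.
      under eq_fun => k do rewrite expr2.
      rewrite expr2; apply: cvgM; apply: cvgB; by [exact: cvg_cst|exact: g'h].
    rewrite is_cvg_limn_einfE; last by apply/cvg_ex; eexists; exact: C.
    exact/cvg_lim.
  have mfg k : measurable_fun setT (fun x => ((f n x - g' k x) ^+ 2)%:E).
    by apply/measurable_EFinP; apply: measurable_funX; apply: measurable_funB.
  apply: le_trans.
    by apply: fatou => // k x _; rewrite lee_fin sqr_ge0.
  apply: (@le_limn_einf _ _ n0) => k nk.
  rewrite (_ : (\int[mu]_x _)%E = (\int[mu]_x ((f n x - g k x) ^+ 2)%:E)%E).
    by apply: n0P => //; rewrite (leq_trans nk)// leq_addr.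
  apply: ge0_ae_eq_integral => //.
  - by apply/measurable_EFinP; apply: measurable_funX; apply: measurable_funB; exact: mf.
  - by move=> x _; rewrite lee_fin sqr_ge0.
  - by move=> x _; rewrite lee_fin sqr_ge0.
  - exists (~` A); split => //; first exact: measurableC.
    move=> x /= nE Ax; apply: nE => _.
    by rewrite /g' indicE mem_set// mul1r.
exists h; split=> //.
have [n0 n0P] := hP 1 ltr01.
have -> : h = (fun x => f n0 x - (f n0 x - h x)) by apply/funext => x; ring.
apply: Lfun2B => //; apply/Lfun2P; split; first exact: measurable_funB.
by apply: le_lt_trans (n0P n0 (leqnn _)) _; exact: ltry.
Unshelve. all: by end_near. Qed.

End square_integrable.
(** * The Hilbert space of weights *)

Section L2_space.
Context {R : realType} {d : nat}.
Local Notation V := 'rV[R]_d.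
Local Notation leb := (@lebesgue_rV R d).
Implicit Types w : set V.

Definition ip2 w (f g : L2 w) : R := \int[leb]_x (f x * g x).

Lemma L2_Lfun w (f : L2 w) : L2_fun f \in Lfun leb 2%:E.
Proof. by have /set_mem[] := valP f. Qed.

Lemma L2_eq0 w (f : L2 w) x : ~ w x -> f x = 0.
Proof. by have /set_mem[_] := valP f; apply. Qed.

Lemma L2_measurable w (f : L2 w) : measurable_fun setT (L2_fun f).
Proof. exact: Lfun_measurable (L2_Lfun f). Qed.

Lemma L2_of w (f : V -> R) : Lp w 2%:E f -> exists g : L2 w, L2_fun g = f.
Proof. by move=> fw; exists (exist _ f (mem_set fw)). Qed.

Lemma L2_linE w a (f g : L2 w) x : L2_fun (a *: f + g) x = a * f x + g x.
Proof. by []. Qed.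

Lemma Lfun2_mul_integrable (f g : V -> R) :
  f \in Lfun leb 2%:E -> g \in Lfun leb 2%:E ->
  leb.-integrable setT (EFin \o (fun x => f x * g x)).
Proof. by move=> f2 g2; apply/Lfun1_integrable; exact: Lfun2_mul_Lfun1. Qed.

Lemma ip2_semi_inner w : semi_inner (@ip2 w).
Proof.
split=> [f g|a f g h|f]; rewrite /ip2.
- by apply: eq_Rintegral => x _; rewrite mulrC.
- under eq_Rintegral do rewrite L2_linE mulrDl -mulrA.
  have fh := Lfun2_mul_integrable (L2_Lfun f) (L2_Lfun h).
  have gh := Lfun2_mul_integrable (L2_Lfun g) (L2_Lfun h).
  by rewrite RintegralD ?RintegralZl//; exact: (integrableZl measurableT a fh).
- by apply: Rintegral_ge0 => x _; rewrite -expr2 sqr_ge0.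
Qed.

Lemma ip2_EFin w (f : L2 w) : (ip2 f f)%:E = (\int[leb]_x (f x ^+ 2)%:E)%E.
Proof.
rewrite /ip2 /Rintegral fineK//.
have := Lfun2_mul_integrable (L2_Lfun f) (L2_Lfun f).
exact: integrable_fin_num.
Qed.

Lemma L2normE w (f : L2 w) : L2norm f = (ipnorm (@ip2 w) f)%:E.
Proof.
rewrite /L2norm unlock /ipnorm -powR12_sqrt; last exact/ip_ge0/ip2_semi_inner.
rewrite -poweR_EFin ip2_EFin; congr (_ `^ _)%E; apply: eq_integral => x _.
by rewrite /= powR_mulrn// real_normK ?num_real.
Qed.

Lemma ip2_complete w : ip_complete (@ip2 w).
Proof.
move=> f fC.
have dE (h g : L2 w) :
    (ip2 (h - g) (h - g))%:E = (\int[leb]_x ((h x - g x) ^+ 2)%:E)%E.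
  by rewrite ip2_EFin.
have [||e e0|h [h2 h0 fh]] := @Lfun2_complete _ _ _ leb (fun n => L2_fun (f n)) (~` w).
- by move=> n; exact: L2_Lfun.
- by move=> n x; exact: L2_eq0.
- have [n0 n0P] := fC _ e0; exists n0 => m n mn nn.
  by rewrite -dE lee_fin n0P.
- have [g gh] : exists g : L2 w, L2_fun g = h by apply: L2_of.
  exists g => e /fh[n0 n0P]; exists n0 => n /n0P.
  by rewrite -lee_fin dE gh.
Qed.

(** The inner product of a finite orthogonal sum of copies of [L2 w], the
    space in which the weights of a network live. *)
Definition ipsum (I : finType) w (f g : I -> L2 w) : R := \sum_i ip2 (f i) (g i).

Lemma ipsum_semi_inner (I : finType) w : semi_inner (@ipsum I w).
Proof.
split=> [f g|a f g h|f]; rewrite /ipsum.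
- by apply: eq_bigr => i _; exact/ipC/ip2_semi_inner.
- rewrite mulr_sumr -big_split/=; apply: eq_bigr => i _.
  by rewrite -[(a *: f + g) i]/(a *: f i + g i); case: (ip2_semi_inner w).
- by apply: sumr_ge0 => i _; exact/ip_ge0/ip2_semi_inner.
Qed.

Lemma le_ip2_ipsum (I : finType) w (f : I -> L2 w) i :
  ip2 (f i) (f i) <= ipsum f f.
Proof.
rewrite /ipsum (bigD1 i)//= lerDl sumr_ge0// => j _.
exact/ip_ge0/ip2_semi_inner.
Qed.

Lemma ipsum_complete (I : finType) w : ip_complete (@ipsum I w).
Proof.
move=> f fC.
have lim i : exists h, forall e, 0 < e -> exists n0, forall n, (n0 <= n)%N ->
    ip2 (f n i - h) (f n i - h) <= e.
  apply: (@ip2_complete w (fun n => f n i)) => e e0.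
  have [n0 n0P] := fC _ e0; exists n0 => m n mn nn.
  by apply: le_trans (n0P _ _ mn nn); exact: (le_ip2_ipsum (f m - f n)).
pose h i := projT1 (cid (lim i)).
have hP i e : 0 < e -> exists n0, forall n, (n0 <= n)%N ->
    ip2 (f n i - h i) (f n i - h i) <= e.
  by rewrite /h; case: cid => /= g; apply.
exists h => e e0.
have e0' : 0 < e / #|I|.+1%:R by rewrite divr_gt0.
pose N i := projT1 (cid (hP i _ e0')).
exists (\max_i N i)%N => n Nn.
have le i : ip2 (f n i - h i) (f n i - h i) <= e / #|I|.+1%:R.
  have : (N i <= n)%N by apply: leq_trans Nn; exact: leq_bigmax.
  by rewrite /N; case: cid => /= n0; apply.
rewrite /ipsum (@le_trans _ _ (\sum_(i : I) e / #|I|.+1%:R))//.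
  by apply: ler_sum => i _; exact: le.
rewrite sumr_const -[X in X <= _]mulr_natr -mulrA ler_piMr ?(ltW e0)// mulrC ler_pdivrMr//.
by rewrite mul1r ler_nat.
Qed.

End L2_space.
(** * Lebesgue measure on the Euclidean space *)

Section lebesgue_rV_theory.
Context {R : realType}.
Local Notation mR := (measurableTypeR R).

Definition box n (A : 'I_n -> set R) : set 'rV[R]_n :=
  [set v | forall i, A i (v ord0 i)].

Definition measurable_boxes n : set (set 'rV[R]_n) :=
  [set box A | A in [set A : 'I_n -> set R | forall i, measurable (A i)]].

Lemma measurable_coord n (i : 'I_n) :
  measurable_fun setT (fun v : 'rV[R]_n => v ord0 i).
Proof. by apply: continuous_measurable_rV; exact: coord_continuous. Qed.

Lemma measurable_box n (A : 'I_n -> set R) : (forall i, measurable (A i)) ->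
  measurable (box A).
Proof.
move=> mA; rewrite (_ : box A =
    \bigcap_(i in [set: 'I_n]) ((fun v : 'rV[R]_n => v ord0 i) @^-1` A i)).
  apply: fin_bigcap_measurable => // i _; rewrite -[X in measurable X]setTI.
  exact: measurable_coord.
by apply/seteqP; split => [v /= h i _|v h i]; [exact: h|exact: (h i Logic.I)].
Qed.

(** Every open set is a countable union of cubes with rational centre. *)
Lemma measurable_boxesE n : @measurable _ 'rV[R]_n = <<s @measurable_boxes n >>.
Proof.
rewrite measurable_rVE; apply/seteqP; split; last first.
  apply: smallest_sub; first exact: smallest_sigma_algebra.
  by move=> _ [A mA <-]; rewrite -measurable_rVE; exact: measurable_box.
apply: smallest_sub; first exact: smallest_sigma_algebra.
move=> U oU.
pose qbox (p : 'rV[rat]_n * nat) : set 'rV[R]_n :=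
  box (fun i => [set x | `|x - ratr (p.1 ord0 i)| < p.2.+1%:R^-1]).
have -> : U = \bigcup_p (if `[< qbox p `<=` U >] then qbox p else set0).
  apply/seteqP; split=> [v Uv|v [p _]]; last by case: asboolP => // pU; exact: pU.
  have /nbhs_ballP[e /= e0 eU] : nbhs v U by apply: open_nbhs_nbhs.
  have e20 : 0 < e / 2 by rewrite divr_gt0.
  have [k ke] : exists k, k.+1%:R^-1 < e / 2.
    by have [k] := ltr_add_invr e20; rewrite add0r => h; exists k.
  have k0 : 0 < k.+1%:R^-1 :> R by rewrite invr_gt0.
  have Q i : exists q : rat, `|v ord0 i - ratr q| < k.+1%:R^-1.
    have [|q] := @rat_in_itvoo R (v ord0 i - k.+1%:R^-1) (v ord0 i + k.+1%:R^-1).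
      by rewrite ltrBlDr -addrA ltrDl addr_gt0.
    rewrite in_itv/= => /andP[h1 h2]; exists q.
    by rewrite ltr_norml ltrBrDr addrC ltrBlDr h2/= ltrBlDl -ltrBlDr h1.
  exists (\row_i projT1 (cid (Q i)), k) => //.
  rewrite asboolT; first by move=> i /=; rewrite mxE; case: cid.
  move=> x xc; apply: eU => /=; split=> // i j; rewrite ord1.
  have := xc j; rewrite /= mxE; case: cid => q /= vq xq.
  rewrite /ball/= (_ : v _ _ - _ = (v ord0 j - ratr q) - (x ord0 j - ratr q)).
    by rewrite (le_lt_trans (ler_normB _ _))// [ltRHS]splitr ltrD// (lt_trans _ ke).
  by rewrite opprB addrA subrK.
(* The index set is countable: [unpickle] turns the union into a sequence. *)
pose f n0 := odflt (0, 0%N) (unpickle n0 : option ('rV[rat]_n * nat)).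
have -> : \bigcup_p (if `[< qbox p `<=` U >] then qbox p else set0) =
    \bigcup_k (if `[< qbox (f k) `<=` U >] then qbox (f k) else set0).
  apply/seteqP; split=> v [p _ pv]; last by exists (f p).
  by exists (pickle p) => //; rewrite /f pickleK.
apply: sigma_algebra_bigcup => k; case: asboolP => _; last exact: sigma_algebra0.
apply: sub_sigma_algebra.
exists (fun i => [set x | `|x - ratr ((f k).1 ord0 i)| < (f k).2.+1%:R^-1]) => // i.
rewrite (_ : mkset _ = ball (ratr ((f k).1 ord0 i) : R) (f k).2.+1%:R^-1).
  exact: measurable_ball.
by apply/seteqP; split=> x /=; rewrite /ball/= distrC.
Qed.

Lemma lebesgue_measure_translate (y : R) (A : set R) : measurable A ->
  lebesgue_measure [set x | A (x + y)] = lebesgue_measure A.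
Proof.
move=> mA.
pose h (x : mR) : mR := x + y.
have mh : measurable_fun setT h by apply: measurable_funD => //; exact: measurable_cst.
pose HH := isMeasurableFun.Build _ _ _ _ h mh.
pose hh : {mfun mR >-> mR} := HB.pack h HH.
have := @lebesgue_measure_unique R (pushforward lebesgue_measure hh).
rewrite /pushforward => H; rewrite [RHS]H//.
move=> _ [[a b]] _ <- /=.
rewrite [X in _ = lebesgue_measure X](_ : _ = `]a - y, b - y]%classic).
  rewrite !lebesgue_measure_itv/= !lte_fin ltrD2r -!EFinB.
  by case: ifP => // _; congr (_%:E); lra.
by apply/seteqP; split=> x /=; rewrite /hh/= /h !in_itv/= ltrBlDr lerBrDr.
Qed.

Lemma lebesgue_box n (A : 'I_n -> set R) : (forall i, measurable (A i)) ->
  lebesgue_rV (box A) = (\prod_(i < n) lebesgue_measure (A i))%E.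
Proof. exact: lebesgue_rV_box. Qed.

Definition cube n (M : R) : set 'rV[R]_n := box (fun=> `[- M, M]%classic).
Arguments cube : clear implicits.

Lemma measurable_cube n (M : R) : measurable (cube n M).
Proof. by apply: measurable_box => i; exact: measurable_itv. Qed.

Lemma lebesgue_rV_cube_lty n (M : R) : (lebesgue_rV (cube n M) < +oo)%E.
Proof.
rewrite /cube lebesgue_box//.
have [r ->] : exists r, lebesgue_measure `[- M, M]%classic = r%:E.
  rewrite lebesgue_measure_itv/=; case: ifP => _; last by exists 0.
  by exists (M - - M); rewrite EFinB.
by rewrite prodEFin ltry.
Qed.

Lemma sub_cube n (w : set 'rV[R]_n) : bounded_set w ->
  exists M, w `<=` cube n M.
Proof.
move=> [M [Mr wM]]; exists (M + 1) => v wv i /=.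
have := wM (M + 1) ltac:(by rewrite ltrDl) v wv; rewrite in_itv/= -ler_norml.
by apply: le_trans; rewrite [leRHS]/Num.norm/= mx_normrE; apply: (le_bigmax _ _ (ord0, i)).
Qed.

Lemma bounded_lebesgue_lty n (w : set 'rV[R]_n) : measurable w -> bounded_set w ->
  (lebesgue_rV w < +oo)%E.
Proof.
move=> mw /sub_cube[M wM]; apply: le_lt_trans (lebesgue_rV_cube_lty n M).
by apply: le_measure => //; rewrite inE//; exact: measurable_cube.
Qed.

Definition translate n (y x : 'rV[R]_n) := x + y.

Lemma translate_continuous n (y : 'rV[R]_n) : continuous (translate y).
Proof.
move=> x; rewrite /translate.
apply: (@continuousD _ _ _ (fun x => x) (cst y)); last exact: cst_continuous.
exact: cvg_id.
Qed.

Lemma measurable_translate n (y : 'rV[R]_n) : measurable_fun setT (translate y).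
Proof.
apply: (measurability _ (@measurable_rVE R n)) => _ [U oU <-]; rewrite setTI.
apply: open_measurable_rV; move/continuousP: (@translate_continuous n y); exact.
Qed.

HB.instance Definition _ n (y : 'rV[R]_n) :=
  isMeasurableFun.Build _ _ _ _ (translate y) (measurable_translate y).

(** Boxes form a pi-system that generates the Borel sets, and on boxes the
    measure is a product of one-dimensional ones. *)
Lemma lebesgue_rV_translate n (y : 'rV[R]_n) (A : set 'rV[R]_n) : measurable A ->
  pushforward (@lebesgue_rV R n) (translate y) A = lebesgue_rV A.
Proof.
move=> mA; apply/esym.
apply: (@measure_unique _ _ _ (@measurable_boxes n)
    (fun k => cube n k%:R)
    _ _ _ _ (@lebesgue_rV R n) (pushforward (@lebesgue_rV R n) (translate y))) => //.
- exact: measurable_boxesE.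
- move=> _ _ [B mB <-] [C mC <-]; exists (fun i => B i `&` C i).
    by move=> i; exact: measurableI.
  apply/seteqP; split=> [v h|v [hB hC] i]; last by split; [exact: hB|exact: hC].
  by split=> i; have [] := h i.
- by move=> k; exists (fun _ => `[- k%:R, k%:R]%classic) => // i; exact: measurable_itv.
- apply/seteqP; split=> // v _.
  have [k kv] : exists k : nat, forall i, `|v ord0 i| <= k%:R.
    exists (\max_i (Num.truncn `|v ord0 i|).+1)%N => i.
    apply: (@le_trans _ _ (Num.truncn `|v ord0 i|).+1%:R).
      by rewrite ltW// truncnS_gt.
    by rewrite ler_nat; exact: (leq_bigmax i).
  by exists k => // i /=; rewrite in_itv/= -ler_norml.
- move=> _ [B mB <-].
  have tB : translate y @^-1` box B = box (fun i => [set x | B i (x + y ord0 i)]).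
    by apply/seteqP; split=> v /= h i; have := h i; rewrite /translate mxE.
  rewrite [LHS](lebesgue_box mB) -[RHS]/(lebesgue_rV (translate y @^-1` box B)).
  rewrite tB lebesgue_box => [|i].
    by apply: eq_bigr => i _; rewrite lebesgue_measure_translate.
  rewrite -[X in measurable X]setTI.
  have : measurable_fun setT (fun x : mR => x + y ord0 i : mR).
    by apply: measurable_funD => //; exact: measurable_cst.
  by move=> /(_ measurableT _ (mB i)).
- by move=> k; exact: lebesgue_rV_cube_lty.
Qed.

Lemma ge0_integral_translate n (y : 'rV[R]_n) (f : 'rV[R]_n -> \bar R) :
  measurable_fun setT f -> (forall x, 0 <= f x)%E ->
  (\int[@lebesgue_rV R n]_x f (x + y)%R = \int[@lebesgue_rV R n]_x f x)%E.
Proof.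
move=> mf f0.
have := @ge0_integral_pushforward _ _ _ _ R (translate y) (measurable_translate y)
  (@lebesgue_rV R n) setT f measurableT mf (fun x _ => f0 x).
rewrite preimage_setT => <-; apply: eq_measure_integral => A mA _.
exact: lebesgue_rV_translate.
Qed.

End lebesgue_rV_theory.
(** * Test functions determine integrable functions *)

Lemma lipschitz1_continuous (R : realType) (M : normedModType R) (f : M -> R) :
  (forall x y, f x <= `|x - y| + f y) -> continuous f.
Proof.
move=> lip x; apply/cvgrPdist_le => e e0; near=> y.
have xy : `|x - y| <= e.
  near: y; apply/nbhs_ballP; exists e => // z; rewrite -ball_normE.
  exact: ltW.
rewrite ler_norml lerBrDl !lerBlDr; apply/andP; split.
  by rewrite addrC (le_trans (lip y x))// lerD2r distrC.
by rewrite (le_trans (lip x y))// lerD2r.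
Unshelve. all: by end_near. Qed.

Lemma clamp_continuous (R : realType) (T : topologicalType) (f : T -> R) a b :
  continuous f -> continuous (fun x => Num.min b (Num.max a (f x))).
Proof.
move=> cf x; apply: (@continuous_min R T (cst b)); first exact: cst_continuous.
by apply: (@continuous_max R T (cst a)); [exact: cst_continuous|exact: cf].
Qed.

Lemma affine_continuous (R : realType) (T : topologicalType) (f : T -> R) a b :
  continuous f -> continuous (fun x => a * f x - b).
Proof.
move=> cf x; apply: (@continuousB _ R^o T (fun x => a * f x) (cst b));
  last exact: cst_continuous.
by apply: (@continuousM R T (cst a) f); [exact: cst_continuous|exact: cf].
Qed.

Section test_functions.
Context {R : realType} {d : nat}.
Local Notation V := 'rV[R]_d.
Local Notation leb := (@lebesgue_rV R d).
Implicit Types (w U A : set V) (x y : V) (f : V -> R).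

(** The cap [1] also serves as the value for empty [A], where there is no
    distance to take the infimum of. *)
Definition capped_dist (A : set V) (x : V) : R :=
  inf ([set 1] `|` [set `|x - a| | a in A]).

Lemma capped_dist_has_inf A x :
  has_inf ([set (1 : R)] `|` [set `|x - a| | a in A]).
Proof.
split; first by exists 1; left.
by exists 0 => _ [->|[a _ <-]].
Qed.

Lemma capped_dist_ge0 A x : 0 <= capped_dist A x.
Proof. by apply: lb_le_inf => [|_ [->|[a _ <-]]//]; case: (capped_dist_has_inf A x). Qed.

Lemma capped_dist_lip A x y : capped_dist A x <= `|x - y| + capped_dist A y.
Proof.
rewrite -lerBlDl; apply: lb_le_inf; first by case: (capped_dist_has_inf A y).
have lb r : ([set (1 : R)] `|` [set `|x - a| | a in A]) r -> capped_dist A x <= r.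
  by move=> h; apply: inf_lbound => //; case: (capped_dist_has_inf A x).
move=> _ [->|[a Aa <-]]; rewrite lerBlDl.
  by rewrite (le_trans (lb 1 _)) ?lerDr//; left.
rewrite (le_trans (lb `|x - a| _))//; first by right; exists a.
by rewrite (le_trans _ (ler_normD _ _))// addrA subrK.
Qed.

Lemma capped_dist_continuous A : continuous (capped_dist A).
Proof. by apply: lipschitz1_continuous; exact: capped_dist_lip. Qed.

Lemma capped_dist_gt0 U x : open U -> U x -> 0 < capped_dist (~` U) x.
Proof.
move=> oU Ux; have /nbhs_ballP[e /= e0 eU] : nbhs x U by apply: open_nbhs_nbhs.
apply: (@lt_le_trans _ _ (Num.min 1 e)); first by rewrite lt_min ltr01.
apply: lb_le_inf => [|_ [->|[a /= Ua <-]]]; first by case: (capped_dist_has_inf (~` U) x).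
  by rewrite ge_min lexx.
rewrite ge_min; apply/orP; right; rewrite leNgt; apply/negP => xa.
by apply: Ua; apply: eU; rewrite -ball_normE.
Qed.

Lemma capped_dist_eq0 (A : set V) x : A x -> capped_dist A x = 0.
Proof.
move=> Ax; apply/le_anti; rewrite capped_dist_ge0 andbT.
apply: inf_lbound; first by case: (capped_dist_has_inf A x).
by right; exists x => //; rewrite subrr normr0.
Qed.

(** Cutoffs that tend to the indicator of [U] as [n] grows; the shift by [1]
    keeps their supports at distance at least [1 / n] from the complement. *)
Definition plateau U (n : nat) (x : V) : R :=
  Num.min 1 (Num.max 0 (n%:R * capped_dist (~` U) x - 1)).

Lemma plateau_bound U n x : `|plateau U n x| <= 1.
Proof.
have p0 : 0 <= plateau U n x by rewrite le_min ler01 le_max lexx.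
by rewrite ger0_norm// ge_min lexx.
Qed.

Lemma plateau_continuous U n : continuous (plateau U n).
Proof.
apply: (@clamp_continuous R V _ 0 1); apply: affine_continuous.
exact: capped_dist_continuous.
Qed.

Lemma plateau_C_c w U n : bounded_set w -> U `<=` w -> C_c w (plateau U n).
Proof.
move=> bw Uw; apply: C_cP; first exact: plateau_continuous.
pose D := fun x => n%:R * capped_dist (~` U) x.
have cD : continuous D.
  move=> x; apply: (@continuousM R V (cst n%:R)); first exact: cst_continuous.
  exact: capped_dist_continuous.
have DU : [set x | 1 <= D x] `<=` U.
  move=> x /= Dx; apply: contrapT => Ux; move: Dx.
  by rewrite /D capped_dist_eq0// mulr0 ler10.
exists [set x | 1 <= D x]; split.
- apply: bounded_closed_compact; last first.
    by apply: (@closed_comp _ _ D [set y | 1 <= y]); [move=> x _; exact: cD|exact: closed_ge].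
  by move: bw => [M [Mr wM]]; exists M; split=> // r Mlr x /DU /Uw; exact: wM.
- exact: subset_trans Uw.
- move=> x; rewrite /plateau; apply: contraNP => /= /negP; rewrite -ltNge => Dx.
  by rewrite (max_idPl _) ?subr_le0 1?ltW// (min_idPr _).
Qed.

Lemma plateau_cvg U x : open U -> plateau U n x @[n --> \oo] --> (\1_U x : R).
Proof.
move=> oU; have [Ux|Ux] := pselect (U x); last first.
  rewrite indicE memNset//; apply: cvg_near_cst; near=> n.
  by rewrite /plateau capped_dist_eq0// mulr0 sub0r (max_idPl _) ?oppr_le0// (min_idPr _).
rewrite indicE mem_set//; apply: cvg_near_cst; near=> n.
have D0 := capped_dist_gt0 oU Ux.
rewrite /plateau (min_idPl _)// le_max; apply/orP; right.
rewrite lerBrDr -ler_pdivrMr//.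
near: n; exact: nbhs_infty_ger.
Unshelve. all: by end_near. Qed.

(** Plateaus show that [f] integrates to zero over every open subset of [w];
    open sets are stable under intersection, so Dynkin's theorem extends this
    to Borel sets. *)
Lemma fundamental_lemma w f : open w -> bounded_set w ->
  leb.-integrable w (EFin \o f) ->
  (forall phi, C_c w phi -> \int[leb]_(x in w) (f x * phi x) = 0) ->
  {ae leb, forall x, w x -> f x = 0}.
Proof.
move=> ow bw fi ftest.
have mw : measurable w by exact: open_measurable_rV.
have mf : measurable_fun w f by have /integrableP[/measurable_EFinP] := fi.
pose I A := (\int[leb]_(x in w `&` A) (f x)%:E)%E.
have Iopen U : open U -> I U = 0%E.
  move=> oU.
  have oUw : open (w `&` U) by exact: openI.
  have mUw := open_measurable_rV oUw.
  have : (\int[leb]_(x in w) ((f x * plateau (w `&` U) n x)%:E))%E @[n --> \oo] -->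
      (\int[leb]_(x in w) ((f x * \1_(w `&` U) x)%:E))%E.
    apply: (@dominated_cvg _ _ _ leb w mw _ _ (fun x => `|(f x)%:E|%E)).
    - move=> n; apply/measurable_EFinP; apply: measurable_funM => //.
      by apply: measurable_funTS; apply: continuous_measurable_rV; exact: plateau_continuous.
    - move=> x _; apply: cvg_EFin; first by near=> n.
      by apply: cvgM; [exact: cvg_cst|exact: plateau_cvg].
    - by [].
    - exact: integrable_abse.
    - move=> n x _; rewrite lee_fin normrM ler_piMr//; exact: plateau_bound.
  have -> : (fun n => \int[leb]_(x in w) ((f x * plateau (w `&` U) n x)%:E))%E = cst 0%E.
    apply/funext => n.
    have C := @plateau_C_c w (w `&` U) n bw (@subIsetl _ _ _).
    rewrite /cst -[RHS]/(0%:E) -(ftest _ C) /Rintegral fineK//.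
    apply: integrable_fin_num => //.
    have -> : (fun x => (f x * plateau (w `&` U) n x)%:E) =
      ((EFin \o f) \* (EFin \o plateau (w `&` U) n))%E by [].
    apply: integrableMl => //.
      apply: measurable_funTS; apply: continuous_measurable_rV; exact: plateau_continuous.
    exists 1; split; first exact: num_real.
    by move=> M M1 x _; rewrite /= (le_trans (plateau_bound _ _ _))// ltW.
  move=> /cvg_lim -/(_ (@ereal_hausdorff _)); rewrite lim_cst// => E.
  rewrite /I integral_mkcondr; apply/esym; rewrite [LHS]E.
  apply: eq_integral => x; rewrite inE => wx.
  rewrite /patch indicE; case: ifPn => [|Ux].
    by rewrite inE => Ux; rewrite mem_set ?mulr1.
  by rewrite memNset ?mulr0// => -[_ Ux']; rewrite mem_set in Ux.
have Imeas A : measurable A -> I A = 0%E.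
  rewrite measurable_rVE; apply: (@dynkin_induction _ _ (@open V) (fun A => I A = 0%E)).
  - exact: measurable_rVE.
  - by move=> B C; exact: openI.
  - by apply: Iopen; exact: openT.
  - exact: Iopen.
  - move=> B mB IB.
    have := Iopen setT openT.
    rewrite /I -(setUv B) setIUr integral_setU; last 4 first.
    + exact: measurableI.
    + by apply: measurableI => //; exact: measurableC.
    + by apply: measurable_funS (measurable_int _ fi) => //; rewrite -setIUr.
    + by apply/disj_setPS; rewrite setIACA setICr setI0.
    by rewrite -/(I B) IB add0e.
  - move=> F mF tF IF.
    rewrite /I setI_bigcupr integral_bigcup.
    + by apply: eseries0 => k _ _; exact: IF.
    + exact: trivIset_setIl.
    + by move=> k; exact: measurableI.
    + apply: integrableS fi => //; rewrite -?setI_bigcupr; last exact: subIsetl.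
      exact/measurableI/bigcup_measurable.
have := @integral_ae_eq _ _ _ leb w mw (cst 0%E) (EFin \o f) fi (measurable_cst _).
case=> [E Ew mE|N [mN N0 subN]].
  rewrite integral0 -(Imeas _ mE) /I.
  by rewrite (_ : w `&` E = E)//; apply/setIidPr.
exists N; split=> // x h; apply: subN => /= h'; apply: h => wx.
by have [] := h' wx.
Unshelve. all: by end_near. Qed.

End test_functions.
(** * Continuous functions vanishing outside a bounded set *)

Section vanishing_functions.
Context {R : realType} {d : nat}.
Local Notation V := 'rV[R]_d.
Local Notation leb := (@lebesgue_rV R d).
Implicit Types (w s : set V) (x y : V).

Lemma C0_eq0 w (f : C0 w) x : ~ w x -> f x = 0.
Proof.
move=> wx; apply/eqP; rewrite -normr_le0; apply/ler_addgt0Pl => e e0; rewrite addr0.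
have /set_mem /(_ e e0)[g [_ [_ gw]] fg] := valP f.
have g0 : g x = 0.
  by apply: contrapT => /eqP gx; apply/wx/gw/subset_closure.
by have := fg x; rewrite g0 subr0.
Qed.

(** Soft thresholding at level [e] moves the support of a continuous function
    into [|f| >= e], which is closed, bounded and inside [w]. *)
Lemma C0_of w (f : V -> R) : bounded_set w -> continuous f ->
  (forall x, ~ w x -> f x = 0) -> exists g : C0 w, C0_fun g = f.
Proof.
move=> bw cf fw.
suff fC : C_0 w f by exists (exist _ f (mem_set fC)).
move=> e e0.
pose c x := Num.min e (Num.max (- e) (f x)).
have cc : continuous c by exact: clamp_continuous.
have c_le x : `|c x| <= e.
  by rewrite ler_norml ge_min lexx /= le_min le_max lexx /= andbT ge0_cp // ltW.
have c_eq x : `|f x| <= e -> c x = f x.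
  by rewrite ler_norml => /andP[h1 h2]; rewrite /c (max_idPr h1) (min_idPr h2).
exists (fun x => f x - c x); last by move=> x; rewrite opprB addrC subrK.
have fKw : [set x | e <= `|f x|] `<=` w.
  move=> x /= ex; apply: contrapT => /fw fx0; move: ex.
  by rewrite fx0 normr0 leNgt e0.
apply: C_cP.
  by move=> x; apply: (@continuousB _ R^o V f c); [exact: cf|exact: cc].
exists [set x | e <= `|f x|]; split => //.
- apply: bounded_closed_compact.
    by move: bw => [M [Mr wM]]; exists M; split=> // r Mlr x /fKw; exact: wM.
  apply: (@closed_comp _ _ (fun x => `|f x|) [set y | e <= y]); last exact: closed_ge.
  move=> x _; apply: (@continuous_comp _ _ _ f Num.norm); first exact: cf.
  exact: norm_continuous.
- move=> x; apply: contraNP => /= /negP; rewrite -ltNge => /ltW fe.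
  by rewrite c_eq// subrr.
Qed.

Lemma C0_measurable w (f : C0 w) : measurable_fun setT (C0_fun f).
Proof. by apply: continuous_measurable_rV; exact: C0_continuous. Qed.

(** The default value [0] is taken only when the restriction of [f] to [s] is
    not square-integrable, which [L2_restrictE] excludes for bounded [f]. *)
Definition L2_restrict s (f : V -> R) : L2 s := insubd (0 : L2 s) (f \_ s).

Section L2_restrict.
Variables (s : set V) (ms : measurable s) (bs : bounded_set s).
Variables (f : V -> R) (M : R).
Hypotheses (mf : measurable_fun setT f) (fM : forall x, s x -> `|f x| <= M).

Let vol := Num.sqrt (fine (leb s)).

Let patch_sq_le : (\int[leb]_x (((f \_ s) x) ^+ 2)%:E <= (M ^+ 2)%:E * leb s)%E.
Proof.
rewrite -integral_cst// integral_mkcond/=.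
apply: ge0_le_integral => //.
- by move=> x _; rewrite lee_fin sqr_ge0.
- apply/measurable_EFinP; apply: measurable_funX.
  by apply/(measurable_restrictT _ ms); exact: measurable_funTS.
- by apply/(measurable_restrictT _ ms); exact: measurable_cst.
- move=> x _; rewrite /patch; case: ifPn => [|_]; last by rewrite expr0n/= lexx.
  rewrite inE lee_fin => /fM fx.
  have M0 : 0 <= M by apply: le_trans fx.
  by rewrite -[f x ^+ 2]real_normK ?num_real// ler_pXn2r ?nnegrE.
Qed.

Lemma L2_restrictE : L2_fun (L2_restrict s f) = f \_ s.
Proof.
rewrite /L2_fun /L2_restrict val_insubd ifT//; apply/mem_set; split; last first.
  by move=> x sx; rewrite /patch memNset.
apply/Lfun2P; split.
  by apply/(measurable_restrictT _ ms); exact: measurable_funTS.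
apply: le_lt_trans patch_sq_le _.
by rewrite lte_mul_pinfty// ?lee_fin ?sqr_ge0// bounded_lebesgue_lty.
Qed.

Lemma L2_restrict_norm_le : 0 <= M -> ipnorm (@ip2 R d s) (L2_restrict s f) <= M * vol.
Proof.
move=> M0; rewrite /ipnorm -[M in X in _ <= X]ger0_norm// -sqrtr_sqr -sqrtrM ?sqr_ge0//.
apply: ler_wsqrtr; rewrite -lee_fin ip2_EFin L2_restrictE EFinM fineK ?patch_sq_le//.
by rewrite ge0_fin_numE// bounded_lebesgue_lty.
Qed.

Lemma ip2_restrict (g : L2 s) : ip2 (L2_restrict s f) g = \int[leb]_(x in s) (f x * g x).
Proof.
rewrite /ip2 L2_restrictE [RHS]Rintegral_mkcond; apply: eq_Rintegral => x _.
by rewrite /patch; case: ifPn => // _; rewrite mul0r.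
Qed.

End L2_restrict.

Definition C0_L2 w (phi : C0 w) : L2 w := L2_restrict w phi.

Lemma C0_L2E w (phi : C0 w) : open w -> bounded_set w ->
  L2_fun (C0_L2 phi) = phi.
Proof.
move=> ow bw.
rewrite (@L2_restrictE w (open_measurable_rV ow) bw _ `|phi|); last 2 first.
- exact: C0_measurable.
- by move=> x _; exact: le_supnorm.
apply/funext => x; rewrite /patch; case: ifPn => // /negP wx.
by rewrite C0_eq0// => /mem_set.
Qed.

End vanishing_functions.
(** * Radon measures as functionals *)

Section radon_measures.
Context {R : realType} {d : nat}.
Implicit Types (w : set 'rV[R]_d).

Lemma radon_lin w (mu : radon w) a (f g : C0 w) :
  mu (a *: f + g) = a * mu f + mu g.
Proof. by have /set_mem[lin _] := valP mu; exact: lin. Qed.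

Lemma radonB w (mu : radon w) (f g : C0 w) : mu (f - g) = mu f - mu g.
Proof. by rewrite addrC -scaleN1r radon_lin mulN1r addrC. Qed.

Lemma radonBE w (mu nu : radon w) (f : C0 w) : radon_fun (mu - nu) f = mu f - nu f.
Proof. by []. Qed.

Lemma radon_bounded w (mu : radon w) :
  exists2 C, 0 <= C & forall f : C0 w, `|mu f| <= C * `|f|.
Proof.
have /set_mem[lin cont] := valP mu.
pose L' : C0 w -> R^o := radon_fun mu.
pose aL := GRing.isLinear.Build R (C0 w) R^o *%R L' lin.
pose lL : {linear C0 w -> R^o} := HB.pack L' aL.
have /linear_boundedP[M [Mr h]] :=
  @continuous_linear_bounded R (C0 w) R^o 0 lL (cont 0).
exists (`|M| + 1); first by rewrite addr_ge0.
by move=> f; apply: h; rewrite (le_lt_trans (ler_norm M))// ltrDl.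
Qed.

Lemma radon_of w (L : C0 w -> R) (C : R) :
  (forall a f g, L (a *: f + g) = a * L f + L g) ->
  (forall f, `|L f| <= C * `|f|) -> exists mu : radon w, forall f, mu f = L f.
Proof.
move=> linL LC.
suff cL : continuous L.
  have LP : [set L : C0 w -> R | scalar L /\ continuous L] L by [].
  by exists (exist _ L (mem_set LP)).
pose L' : C0 w -> R^o := L.
pose aL := GRing.isLinear.Build R (C0 w) R^o *%R L' linL.
pose lL : {linear C0 w -> R^o} := HB.pack L' aL.
apply: (@bounded_linear_continuous R (C0 w) R^o lL).
apply/linear_boundedP; exists C; split; first exact: num_real.
by move=> r Cr psi; rewrite (le_trans (LC psi))// ler_wpM2r// ltW.
Qed.

Lemma le_tvnorm w (mu : radon w) (B : R) : (tvnorm mu <= B%:E)%E ->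
  forall f : C0 w, `|mu f| <= B * `|f|.
Proof.
move=> muB f; have [f0|f0] := eqVneq `|f| 0.
  have /eqP := f0; rewrite normr_eq0 => /eqP ->.
  have := radonB mu 0 0; rewrite subr0 subrr => ->.
  by rewrite !normr0 mulr0.
have fp : 0 < `|f| by rewrite lt_neqAle eq_sym f0 normr_ge0.
have : (`|mu (`|f|^-1 *: f)|%:E <= B%:E)%E.
  apply: le_trans muB; apply: ereal_sup_ubound; exists (`|f|^-1 *: f) => //=.
  by rewrite normrZ normfV normr_id mulVf.
have -> : mu (`|f|^-1 *: f) = `|f|^-1 * mu f.
  have := radon_lin mu `|f|^-1 f 0; rewrite addr0 => ->.
  by have := radonB mu 0 0; rewrite subr0 subrr => ->; rewrite addr0.
by rewrite lee_fin normrM normfV normr_id ler_pdivrMl// mulrC.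
Qed.

End radon_measures.

(** * Correlation with a kernel *)

Lemma bounded_closure (R : realType) (M : normedModType R) (A : set M) :
  bounded_set A -> bounded_set (closure A).
Proof.
move=> [C [Cr AC]]; exists C; split=> // r Cr'.
have cB : closed [set x : M | `|x| <= r].
  apply: (@closed_comp M R Num.norm [set y | y <= r]); last exact: closed_le.
  by move=> y _; exact: norm_continuous.
have : closure A `<=` closure [set x : M | `|x| <= r].
  by apply: closure_subset; exact: AC.
by rewrite -[X in _ `<=` X -> _](closure_id _).1.
Qed.

(** Compactness of [A] makes the continuity of translations uniform on it. *)
Lemma translate_near_uniform (R : realType) (M : normedModType R) (f : M -> R)
    (A : set M) (y : M) (e : R) : continuous f -> compact A -> 0 < e ->
  \forall y' \near y, A `<=` [set x | `|f (x + y) - f (x + y')| <= e].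
Proof.
move=> cf cA e0.
move: cA => /compact_near_coveringP /(_ M (nbhs y)
  (fun y' x => `|f (x + y) - f (x + y')| <= e)); apply => x Ax.
have e2 : 0 < e / 2 by rewrite divr_gt0.
have fxy : \forall z \near x + y, `|f (x + y) - f z| <= e / 2.
  by move: (cf (x + y)) => /cvgrPdist_le; apply.
have add1 : \forall z \near (x, y), `|f (x + y) - f (z.1 + z.2)| <= e / 2.
  have c2 : (fun z : M * M => z.1 + z.2) @ (x, y) --> x + y.
    by apply: cvgD; [exact: cvg_fst|exact: cvg_snd].
  exact: (c2 _ fxy).
have add2 : \forall z \near (x, y), `|f (x + y) - f (z.1 + y)| <= e / 2.
  have c1 : (fun z : M * M => z.1 + y) @ (x, y) --> x + y.
    by apply: cvgD; [exact: cvg_fst|exact: (@cvg_cst _ y)].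
  exact: (c1 _ fxy).
near=> z.
have -> : f (z.1 + y) - f (z.1 + z.2) =
    (f (x + y) - f (z.1 + z.2)) - (f (x + y) - f (z.1 + y)) by ring.
rewrite (le_trans (ler_normB _ _))// [leRHS]splitr lerD//; near: z; by [].
Unshelve. all: by end_near. Qed.

Lemma near_dist_continuous (R : realType) (T : topologicalType) (f : T -> R) :
  (forall y e, 0 < e -> \forall y' \near y, `|f y - f y'| <= e) -> continuous f.
Proof. by move=> fn y; apply/cvgrPdist_le => e; exact: fn. Qed.

Section correlation.
Context {R : realType} {d : nat}.
Local Notation V := 'rV[R]_d.
Local Notation leb := (@lebesgue_rV R d).
Variables (w s : set V).
Hypotheses (ow : open w) (bw : bounded_set w) (os : open s) (bs : bounded_set s).

Let ms : measurable s. Proof. exact: open_measurable_rV. Qed.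

Lemma minkowski_sub_bounded : bounded_set (minkowski_sub w s).
Proof.
move: bw bs => [M [Mr wM]] [P [Pr sP]].
exists (M + 1 + (P + 1)); split; first by rewrite num_real.
move=> r rMP _ [x wx [y sy <-]] /=.
rewrite (le_trans _ (ltW rMP))// (le_trans (ler_normB _ _))// lerD//.
- by apply: wM => //; rewrite ltrDl.
- by apply: sP => //; rewrite ltrDl.
Qed.

Lemma minkowski_sub_open : open (minkowski_sub w s).
Proof.
have -> : minkowski_sub w s = \bigcup_(y in s) (translate y @^-1` w).
  apply/seteqP; split=> [_ [x wx [y sy <-]]|x [y sy wxy]].
    by exists y => //=; rewrite /translate subrK.
  by exists (translate y x) => //; exists y => //; rewrite /translate addrK.
apply: bigcup_open => y _.
by apply: open_comp => // x _; exact: translate_continuous.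
Qed.

Definition slice (phi : C0 w) (y : V) : L2 s := L2_restrict s (fun x : V => phi (x + y)).

Lemma slice_measurable (phi : C0 w) y :
  measurable_fun setT (fun x : V => phi (x + y)).
Proof.
exact: measurableT_comp (C0_measurable phi) (measurable_translate y).
Qed.

Lemma sliceE (phi : C0 w) y :
  L2_fun (slice phi y) = (fun x : V => phi (x + y)) \_ s.
Proof.
apply: (@L2_restrictE R d s ms bs _ `|phi|); first exact: slice_measurable.
by move=> x _; exact: le_supnorm.
Qed.

Definition corr (phi : C0 w) (g : L2 s) (y : V) : R := ip2 (slice phi y) g.

Lemma corrE phi g y : corr phi g y = \int[leb]_(x in s) (phi (x + y) * g x).
Proof.
apply: (@ip2_restrict R d s ms bs _ `|phi|); first exact: slice_measurable.
by move=> x _; exact: le_supnorm.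
Qed.

Lemma slice_lin a (phi psi : C0 w) y :
  slice (a *: phi + psi) y = a *: slice phi y + slice psi y.
Proof.
apply/val_inj/funext => x.
rewrite -[LHS]/(L2_fun (slice (a *: phi + psi) y) x).
rewrite -[RHS]/(L2_fun (a *: slice phi y + slice psi y) x).
rewrite L2_linE !sliceE /patch; case: ifPn => // _.
by rewrite mulr0 addr0.
Qed.

Lemma corr_linl a (phi psi : C0 w) g y :
  corr (a *: phi + psi) g y = a * corr phi g y + corr psi g y.
Proof. by rewrite /corr slice_lin; case: (@ip2_semi_inner R d s). Qed.

Lemma corr_eq0 phi g y : ~ minkowski_sub w s y -> corr phi g y = 0.
Proof.
move=> wsy; rewrite corrE (@eq_Rintegral _ _ _ _ s (cst 0)).
  by rewrite Rintegral_cst// mul0r.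
move=> x; rewrite inE => sx /=; rewrite C0_eq0 ?mul0r// => wxy; apply: wsy.
by exists (x + y) => //; exists x => //; rewrite addrAC subrr add0r.
Qed.

(** Translating a test function moves it continuously in [L2 s], uniformly in
    the kernel, because the closure of [s] is compact. *)
Lemma corr_equicontinuous phi y e : 0 < e ->
  \forall y' \near y, forall g,
    `|corr phi g y - corr phi g y'| <= e * ipnorm (@ip2 R d s) g.
Proof.
move=> e0; pose c := Num.sqrt (fine (leb s)) + 1.
have c0 : 0 < c by rewrite ltr_wpDl.
have cK : compact (closure s).
  apply: bounded_closed_compact; last exact: closed_closure.
  exact: bounded_closure.
have ec : 0 < e / c by rewrite divr_gt0.
have := translate_near_uniform y (@C0_continuous R d w phi) cK ec.
apply: filterS => y' phiy g.
rewrite /corr -(ipBl (@ip2_semi_inner R d s)).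
rewrite (le_trans (ip_cauchy_schwarz (@ip2_semi_inner R d s) _ _))//.
rewrite ler_wpM2r ?ipnorm_ge0//.
have -> : slice phi y - slice phi y' =
    L2_restrict s (fun x : V => phi (x + y) - phi (x + y')).
  apply/val_inj/funext => x.
  rewrite -[LHS]/(L2_fun (slice phi y - slice phi y') x).
  rewrite -[RHS]/(L2_fun (L2_restrict s
    (fun x : V => phi (x + y) - phi (x + y'))) x).
  rewrite (@L2_restrictE R d s ms bs _ (e / c)); last 2 first.
  - by apply: measurable_funB; exact: slice_measurable.
  - by move=> z sz; apply: phiy; exact: subset_closure.
  rewrite -[LHS]/(L2_fun (slice phi y) x - L2_fun (slice phi y') x) !sliceE /patch.
  by case: ifPn => // _; rewrite subrr.
apply: le_trans (@L2_restrict_norm_le R d s ms bs _ (e / c) _ _ _) _.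
- by apply: measurable_funB; exact: slice_measurable.
- by move=> z sz; apply: phiy; exact: subset_closure.
- exact: ltW.
by rewrite mulrAC ler_pdivrMr// ler_pM2l// lerDl.
Qed.

(** Young's inequality: by translation invariance every slice of [phi] has at
    most the [L2] norm of [phi]. *)
Lemma corr_le phi g y :
  `|corr phi g y| <= ipnorm (@ip2 R d w) (C0_L2 phi) * ipnorm (@ip2 R d s) g.
Proof.
rewrite (le_trans (ip_cauchy_schwarz (@ip2_semi_inner R d s) _ _))//.
rewrite ler_wpM2r ?ipnorm_ge0// ler_wsqrtr// -lee_fin !ip2_EFin sliceE C0_L2E//.
have mphi2 : measurable_fun setT (fun x => ((C0_fun phi x) ^+ 2)%:E).
  by apply/measurable_EFinP; apply: measurable_funX; exact: C0_measurable.
rewrite -(ge0_integral_translate y mphi2); last by move=> x; rewrite lee_fin sqr_ge0.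
apply: ge0_le_integral => //.
- by move=> x _; rewrite lee_fin sqr_ge0.
- apply/measurable_EFinP; apply: measurable_funX.
  by apply/(measurable_restrictT _ ms); apply: measurable_funTS; exact: slice_measurable.
- by apply/measurable_EFinP; apply: measurable_funX; exact: slice_measurable.
- move=> x _; rewrite lee_fin /patch; case: ifPn => // _.
  by rewrite expr0n/= sqr_ge0.
Qed.

Lemma corr_continuous phi g : continuous (corr phi g).
Proof.
apply: near_dist_continuous => y e e0.
have c0 : 0 < ipnorm (@ip2 R d s) g + 1 by rewrite ltr_wpDl// ipnorm_ge0.
have := corr_equicontinuous phi y (divr_gt0 e0 c0).
apply: filterS => y' /(_ g) /le_trans; apply.
by rewrite mulrAC ler_pdivrMr// ler_pM2l// lerDl.
Qed.

(** The correlation vanishes outside the bounded set [w - s], so it belongs to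
    [C_0] and the default value [0] is not used. *)
Definition corrC0 phi g : C0 (minkowski_sub w s) :=
  insubd (0 : C0 (minkowski_sub w s)) (corr phi g).

Lemma corrC0E phi g : C0_fun (corrC0 phi g) = corr phi g.
Proof.
have [|||psi psiE] := @C0_of R d (minkowski_sub w s) (corr phi g).
- exact: minkowski_sub_bounded.
- exact: corr_continuous.
- by move=> y; exact: corr_eq0.
by rewrite /C0_fun val_insubd -psiE (valP psi).
Qed.

End correlation.
(** * Convolution of a measure with a kernel *)

Section convolution.
Context {R : realType} {d : nat}.
Local Notation V := 'rV[R]_d.
Local Notation leb := (@lebesgue_rV R d).
Variables (w s : set V).
Hypotheses (ow : open w) (bw : bounded_set w) (os : open s) (bs : bounded_set s).

Let mw : measurable w. Proof. exact: open_measurable_rV. Qed.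

Lemma Lp2_of_L2 (h : L2 w) : Lp w 2%:E h.
Proof. by split; [exact: L2_Lfun|exact: L2_eq0]. Qed.

(** On a set of finite measure, [|f| <= 1 + |f| ^ q] is integrable. *)
Lemma Lp_integrable f (q : R) : 1 < q -> Lp w q%:E f ->
  leb.-integrable w (EFin \o f).
Proof.
move=> q1 [fq _].
have mf : measurable_fun w f by apply: measurable_funTS; exact: Lfun_measurable fq.
have fqi : leb.-integrable w (fun x => (`|f x| `^ q)%:E).
  by apply: integrableS (Lfun_integrable (ltW q1) fq).
have i1 : leb.-integrable w (EFin \o cst 1).
  apply/integrableP; split; first exact/measurable_EFinP.
  rewrite /= normr1 integral_cst// mul1e; exact: bounded_lebesgue_lty.
apply: le_integrable (integrableD mw i1 fqi) => //; first exact/measurable_EFinP.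
move=> x _; rewrite lee_fin [leRHS]ger0_norm ?addr_ge0 ?powR_ge0//.
have [f1|f1] := leP `|f x| 1; first by rewrite (le_trans f1)// lerDl powR_ge0.
by rewrite (@le_trans _ _ (`|f x| `^ q))// ?lerDr// -[leLHS]powRr1// ler_powR// ltW.
Qed.

Lemma Lp_C0_integrable f (q : R) (phi : C0 w) : 1 < q -> Lp w q%:E f ->
  leb.-integrable w (EFin \o (fun x => f x * phi x)).
Proof.
move=> q1 fq.
have -> : EFin \o (fun x => f x * phi x) = ((EFin \o f) \* (EFin \o phi))%E by [].
apply: integrableMl => //; first exact: Lp_integrable fq.
  by apply: measurable_funTS; exact: C0_measurable.
exists (supnorm phi); split; first exact: num_real.
by move=> M sM x _; rewrite /= (le_trans (le_supnorm _ _))// ltW.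
Qed.

(** On a set of finite measure, [|h| ^ q <= 1 + |h| ^ 2] is integrable. *)
Lemma Lp_of_L2 (h : L2 w) (q : R) : 1 < q <= 2 -> Lp w q%:E h.
Proof.
move=> /andP[q1 q2]; split; last exact: L2_eq0.
rewrite inE; apply/andP; split; rewrite inE/=; first exact: L2_measurable.
rewrite /finite_norm unlock poweR_lty//.
have [_ h2] := (Lfun2P _ _).1 (L2_Lfun h).
have mh := L2_measurable h.
apply: (@le_lt_trans _ _ (\int[leb]_x ((\1_w x)%:E + (h x ^+ 2)%:E))%E).
  apply: ge0_le_integral => //.
  - by move=> x _; exact: poweR_ge0.
  - apply/measurable_EFinP; apply: (measurableT_comp (measurable_powR _)) => //.
    exact: measurableT_comp.
  - apply: emeasurable_funD; apply/measurable_EFinP => //.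
    exact: measurable_funX.
  move=> x _; rewrite /= lee_fin.
  have [wx|wx] := pselect (w x); last first.
    have q0 : q != 0 by rewrite gt_eqF// (lt_trans ltr01).
    by rewrite L2_eq0// normr0 powR0// indicE expr0n/= addr0.
  rewrite indicE mem_set//=.
  have [f1|f1] := leP `|h x| 1.
    rewrite (@le_trans _ _ 1)// ?lerDl ?sqr_ge0//.
    have e1 : 1 `^ q = 1 :> R by rewrite powR1.
    by rewrite -[leRHS]e1 ge0_ler_powR// ?nnegrE// (le_trans ler01)// ltW.
  rewrite -[h x ^+ 2]real_normK ?num_real// -powR_mulrn//.
  by rewrite (@le_trans _ _ (`|h x| `^ 2%:R))// ?lerDr// ler_powR// ltW.
rewrite ge0_integralD//; last 3 first.
- by apply/measurable_EFinP.
- by move=> x _; rewrite lee_fin sqr_ge0.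
- by apply/measurable_EFinP; exact: measurable_funX.
rewrite lte_add_pinfty// integral_indic// setIT.
exact: bounded_lebesgue_lty.
Qed.

(** Young's inequality makes [phi |-> mu (corrC0 phi g)] bounded for the [L2]
    norm of [phi], so the representation theorem provides the density of
    [mu * g] without any measure being attached to the functional [mu]. *)
Lemma conv_density (mu : radon (minkowski_sub w s)) (g : L2 s) :
  exists h : L2 w, forall phi : C0 w,
    \int[leb]_(x in w) (h x * phi x) = mu (corrC0 phi g).
Proof.
have [C Cge0 muC] := radon_bounded mu.
have lin a (phi psi : C0 w) :
    corrC0 (a *: phi + psi) g = a *: corrC0 phi g + corrC0 psi g.
  apply/val_inj/funext => y.
  rewrite -[LHS]/(C0_fun _ y).
  rewrite -[RHS]/(a * C0_fun (corrC0 phi g) y + C0_fun (corrC0 psi g) y).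
  by rewrite !corrC0E// corr_linl.
have [|||h hP] := @riesz_along R (L2 w) _ (@ip2_semi_inner R d w) (C0 w)
    (@C0_L2 R d w) (fun phi => mu (corrC0 phi g))
    (C * ipnorm (@ip2 R d s) g) (@ip2_complete R d w).
- move=> a phi psi; apply/val_inj/funext => x.
  rewrite -[LHS]/(L2_fun _ x).
  rewrite -[RHS]/(a * L2_fun (C0_L2 phi) x + L2_fun (C0_L2 psi) x).
  by rewrite !C0_L2E.
- by move=> a phi psi; rewrite lin radon_lin.
- move=> phi; rewrite (le_trans (muC _))// -mulrA ler_wpM2l//.
  by apply: supnorm_le => y; rewrite corrC0E// mulrC corr_le.
exists h => phi; rewrite hP /ip2 C0_L2E// Rintegral_mkcond.
by apply: eq_Rintegral => x _; rewrite /patch; case: ifPn => // /negP wx;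
  rewrite C0_eq0 ?mulr0// => /mem_set.
Qed.

Lemma conv_is_conv (mu : radon (minkowski_sub w s)) (g : L2 s) :
  is_conv mu g (Defs.conv mu g).
Proof.
apply: getPex; have [h hP] := conv_density mu g; exists (L2_fun h); split.
  by move=> q; exact: Lp_of_L2.
move=> phi phiw.
pose phi0 : C0 w := exist _ phi (mem_set (C_c_C_0 phiw)).
exists (corrC0 phi0 g); last exact: (hP phi0).
by move=> y; rewrite corrC0E// corrE.
Qed.

Lemma conv_Lp (mu : radon (minkowski_sub w s)) (g : L2 s) : Lp w 2%:E (Defs.conv mu g).
Proof. by have [+ _] := conv_is_conv mu g; apply; rewrite ltr1n lexx. Qed.

(** The defining identity of [mu * g] extends from [C_c w] to [C_0 w] because
    [mu * g] is determined almost everywhere by its values on [C_c w]. *)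
Lemma conv_pairing (mu : radon (minkowski_sub w s)) (g : L2 s) (phi : C0 w) :
  \int[leb]_(x in w) (Defs.conv mu g x * phi x) = mu (corrC0 phi g).
Proof.
have [h hP] := conv_density mu g.
have [_ cP] := conv_is_conv mu g.
have c2 := conv_Lp mu g; have h2 := Lp2_of_L2 h.
have q1 : 1 < 2 :> R by rewrite ltr1n.
have ci (psi : C0 w) := Lp_C0_integrable psi q1 c2.
have hi (psi : C0 w) := Lp_C0_integrable psi q1 h2.
have ae : {ae leb, forall x, w x -> Defs.conv mu g x - h x = 0}.
  apply: (fundamental_lemma ow bw).
    exact: (integrableB mw (Lp_integrable q1 c2) (Lp_integrable q1 h2)).
  move=> psi psiw.
  pose psi0 : C0 w := exist _ psi (mem_set (C_c_C_0 psiw)).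
  under eq_Rintegral do rewrite mulrBl.
  rewrite RintegralB//; [|exact: (ci psi0)|exact: (hi psi0)].
  have [u uE ->] := cP _ psiw; rewrite (hP psi0).
  suff -> : u = corrC0 psi0 g by rewrite subrr.
  apply/val_inj/funext => y.
  by rewrite -[LHS]/(C0_fun u y) -[RHS]/(C0_fun _ y) corrC0E// corrE.
rewrite -hP /Rintegral; congr fine; apply: ae_eq_integral => //.
- by have /integrableP[] := ci phi.
- by have /integrableP[] := hi phi.
- case: ae => N [mN N0 subN]; exists N; split=> // x nE; apply: subN => /= E.
  by apply: nE => wx; congr (_%:E); have /eqP := E wx; rewrite subr_eq0 => /eqP ->.
Qed.

End convolution.
(** * Weak limits *)

Section weak_limits.
Context {R : realType} {d : nat}.

(** Limits along an ultrafilter of the values of bounded functionals depend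
    linearly on the test function and keep the bound. *)
Lemma weak_star_compactness (w : set 'rV[R]_d) (I : Type) (U : set_system I)
    (mu_ : I -> radon w) (B : R) : UltraFilter U ->
  (forall i, tvnorm (mu_ i) <= B%:E)%E ->
  exists mu : radon w, forall f : C0 w, mu_ i f @[i --> U] --> mu f.
Proof.
move=> UU muB.
have bnd (f : C0 w) : \forall i \near U, `|mu_ i f| <= B * `|f|.
  by apply: nearW => i; exact: le_tvnorm.
pose L f := ulim U (fun i => mu_ i f).
have LP f : mu_ i f @[i --> U] --> L f by exact: ulimP (bnd f).
have [||mu muL] := @radon_of R d w L B.
- move=> a f g; apply: ulim_unique; under eq_fun do rewrite radon_lin.
  by apply: cvgD (LP g); apply: cvgM (LP f); exact: cvg_cst.
- by move=> f; apply: cvgr_to_le (bnd f); apply: cvg_norm; exact: LP.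
by exists mu => f; rewrite muL.
Qed.

Section convolution_limit.
Variables (w s : set 'rV[R]_d).
Hypotheses (bw : bounded_set w) (os : open s) (bs : bounded_set s).
Variables (I : Type) (F : set_system I) (FF : ProperFilter F).
Variables (g_ : I -> L2 s) (g : L2 s) (D : R).
Hypothesis g_bnd : forall i, ipnorm (@ip2 R d s) (g_ i) <= D.
Hypothesis g_cvg : forall z, ip2 (g_ i) z @[i --> F] --> ip2 g z.

(** Correlation with a fixed test function is a compact operator: the weak
    convergence of the kernels gives pointwise convergence, which
    equicontinuity makes uniform on the compact closure of [w - s]. *)
Lemma corr_cvg_uniform (phi : C0 w) e : 0 < e ->
  \forall i \near F, `|corrC0 phi (g_ i) - corrC0 phi g| <= e.
Proof.
move=> e0.
pose M := `|D| + ipnorm (@ip2 R d s) g + 1.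
have M0 : 0 < M by rewrite ltr_wpDl// addr_ge0// ipnorm_ge0.
have D_M : D <= M.
  by rewrite /M -addrA (le_trans (ler_norm D))// lerDl addr_ge0// ipnorm_ge0.
have g_M : ipnorm (@ip2 R d s) g <= M by rewrite /M addrAC lerDr addr_ge0.
have e3 : 0 < e / 3 by rewrite divr_gt0.
have e3M : 0 < e / 3 / M by rewrite divr_gt0.
have small (h : L2 s) : ipnorm (@ip2 R d s) h <= M ->
    e / 3 / M * ipnorm (@ip2 R d s) h <= e / 3.
  by move=> hM; rewrite mulrAC ler_pdivrMr// ler_pM2l.
have cK : compact (closure (minkowski_sub w s)).
  apply: bounded_closed_compact; last exact: closed_closure.
  by apply: bounded_closure; exact: minkowski_sub_bounded.
move: cK => /compact_near_coveringP /(_ I F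
  (fun i y => `|corr phi (g_ i) y - corr phi g y| <= e) _) cover.
have {}cover : \forall i \near F, closure (minkowski_sub w s) `<=`
    [set y | `|corr phi (g_ i) y - corr phi g y| <= e].
  apply: cover => y _.
  have Y := corr_equicontinuous os bs phi y e3M.
  have P : \forall i \near F, `|corr phi (g_ i) y - corr phi g y| <= e / 3.
    have := @g_cvg (slice s phi y); move/cvgrPdist_le => /(_ _ e3).
    apply: filterS => i.
    by rewrite /corr !(ipC (@ip2_semi_inner R d s) (slice s phi y)) distrC.
  exists ([set y' | forall g0 : L2 s, `|corr phi g0 y - corr phi g0 y'| <=
      e / 3 / M * ipnorm (@ip2 R d s) g0],
      [set i | `|corr phi (g_ i) y - corr phi g y| <= e / 3]) => //.
  move=> -[y' i] [/= Yy' Pi].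
  have -> : corr phi (g_ i) y' - corr phi g y' =
      (corr phi (g_ i) y - corr phi g y) + (corr phi g y - corr phi g y')
      - (corr phi (g_ i) y - corr phi (g_ i) y') by ring.
  have -> : e = e / 3 + e / 3 + e / 3 by field.
  rewrite (le_trans (ler_normB _ _))// lerD//.
    rewrite (le_trans (ler_normD _ _))// lerD//.
    by rewrite (le_trans (Yy' _))// small.
  by rewrite (le_trans (Yy' _))// small// (le_trans (g_bnd i)).
apply: filterS cover => i corri; apply: supnorm_le => y.
rewrite -[C0_fun _ y]/(C0_fun (corrC0 phi (g_ i)) y - C0_fun (corrC0 phi g) y) !corrC0E//.
have [wy|wy] := pselect (minkowski_sub w s y).
  by apply: corri; exact: subset_closure.
by rewrite !(corr_eq0 os bs _ _ wy) subr0 normr0 ltW.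
Qed.

(** Bounded weak-star convergent measures may be evaluated at uniformly
    convergent functions, so the bilinear pairing passes to the limit. *)
Lemma conv_cvg (mu_ : I -> radon (minkowski_sub w s))
    (mu : radon (minkowski_sub w s)) (B : R) (phi : C0 w) :
  (forall i, tvnorm (mu_ i) <= B%:E)%E ->
  (forall f, mu_ i f @[i --> F] --> mu f) ->
  mu_ i (corrC0 phi (g_ i)) @[i --> F] --> mu (corrC0 phi g).
Proof.
move=> muB mu_mu; apply/cvgrPdist_le => e e0.
pose M := `|B| + 1.
have M0 : 0 < M by rewrite ltr_wpDl.
have B_M : B <= M by rewrite (le_trans (ler_norm B))// lerDl.
have e2 : 0 < e / 2 by rewrite divr_gt0.
have C1 := corr_cvg_uniform phi (divr_gt0 e2 M0).
have C2 := mu_mu (corrC0 phi g); move/cvgrPdist_le : C2 => /(_ _ e2) C2.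
apply: filterS2 C1 C2 => i h1 h2.
have -> : mu (corrC0 phi g) - mu_ i (corrC0 phi (g_ i)) =
    (mu (corrC0 phi g) - mu_ i (corrC0 phi g)) -
    mu_ i (corrC0 phi (g_ i) - corrC0 phi g) by rewrite radonB; ring.
rewrite (le_trans (ler_normB _ _))// [leRHS]splitr lerD//.
rewrite (le_trans (le_tvnorm (muB i) _))//.
rewrite (@le_trans _ _ (M * (e / 2 / M)))//.
  rewrite (@le_trans _ _ (M * `|corrC0 phi (g_ i) - corrC0 phi g|))// ?ler_wpM2r//.
  by rewrite ler_wpM2l// ltW.
by rewrite mulrC divfK// gt_eqF.
Qed.

End convolution_limit.

End weak_limits.
(** * Lower semicontinuity along a filter *)

Section lsc_along.
Context {R : realType} {I : Type} (F : set_system I) {FF : ProperFilter F}.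
Local Open Scope ereal_scope.

(** This is [a <= liminf a_] along [F], with real levels so that infinite
    values need no case distinction. *)
Definition lsc_along (a_ : I -> \bar R) (a : \bar R) : Prop :=
  forall r : R, r%:E < a -> \forall i \near F, r%:E < a_ i.

Lemma lsc_along_cst (a : \bar R) : lsc_along (fun=> a) a.
Proof. by move=> r ra; exact: nearW. Qed.

Lemma lt_split (a b : \bar R) (r : R) : 0 <= a -> 0 <= b -> r%:E < a + b ->
  exists r1 r2 : R, [/\ r1%:E < a, r2%:E < b & r = (r1 + r2)%R].
Proof.
case: a => [a| |]//; case: b => [b| |]// _ _.
- rewrite -EFinD lte_fin => rab.
  exists (a - (a + b - r) / 2)%R, (b - (a + b - r) / 2)%R.
  by rewrite !lte_fin; split; [lra|lra|field].
- by exists (a - 1)%R, (r - a + 1)%R; rewrite lte_fin ltry; split=> //; [lra|ring].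
- by exists (r - b + 1)%R, (b - 1)%R; rewrite lte_fin ltry; split=> //; [lra|ring].
- by exists 0%R, r; rewrite !ltry; split=> //; rewrite add0r.
Qed.

Lemma lsc_alongD (a_ b_ : I -> \bar R) (a b : \bar R) : 0 <= a -> 0 <= b ->
  lsc_along a_ a -> lsc_along b_ b -> lsc_along (fun i => a_ i + b_ i) (a + b).
Proof.
move=> a0 b0 la lb r /(lt_split a0 b0)[r1 [r2 [/la ha /lb hb ->]]].
by apply: filterS2 ha hb => i h1 h2; rewrite EFinD lteD.
Qed.

Lemma lsc_along_sum (T : finType) (a_ : I -> T -> \bar R) (a : T -> \bar R) :
  (forall t, 0 <= a t) -> (forall t, lsc_along (fun i => a_ i t) (a t)) ->
  lsc_along (fun i => \sum_t a_ i t) (\sum_t a t).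
Proof.
move=> a0 la; elim: (index_enum T) => [|t r IH].
  by rewrite big_nil; under eq_fun do rewrite big_nil; exact: lsc_along_cst.
rewrite big_cons; under eq_fun do rewrite big_cons.
by apply: lsc_alongD => //; exact: sume_ge0.
Qed.

End lsc_along.

Section weak_star_lsc.
Context {R : realType} {d : nat} {I : Type} (F : set_system I).
Context {FF : ProperFilter F}.

Lemma tvnorm_ge0 (w : set 'rV[R]_d) (mu : radon w) : (0 <= tvnorm mu)%E.
Proof.
apply: (@le_trans _ _ `|mu 0|%:E); first by rewrite lee_fin.
by apply: ereal_sup_ubound; exists 0 => //=; rewrite normr0 ler01.
Qed.

(** The total variation is a supremum of weak-star continuous functions. *)
Lemma tvnorm_lsc (w : set 'rV[R]_d) (mu_ : I -> radon w) (mu : radon w) :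
  (forall f : C0 w, mu_ i f @[i --> F] --> mu f) ->
  lsc_along F (fun i => tvnorm (mu_ i)) (tvnorm mu).
Proof.
move=> mumu r /ereal_sup_gt[_ [f f1 <-]]; rewrite lte_fin => rf.
have : `|mu_ i f| @[i --> F] --> `|mu f| by apply: cvg_norm; exact: mumu.
move/cvgr_gt => /(_ _ rf); apply: filterS => i rfi.
apply: (@lt_le_trans _ _ `|mu_ i f|%:E); first by rewrite lte_fin.
by apply: ereal_sup_ubound; exists f.
Qed.

Lemma weak_star_lsc_along (Omega Sigma : set 'rV[R]_d) (N : nat -> nat) l
    (J : measures Omega Sigma N l -> \bar R)
    (m_ : I -> measures Omega Sigma N l) (m : measures Omega Sigma N l) :
  weak_star_lsc J ->
  (forall n (f : C0 (layer_domain Omega Sigma l)), m_ i n f @[i --> F] --> m n f) ->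
  lsc_along F (fun i => J (m_ i)) (J m).
Proof.
move=> lscJ mm r rJ; have [W mW WJ] := lscJ m r rJ.
have ev : {ptws, (fun i => weak_star_eval (m_ i)) @ F --> weak_star_eval m}.
  (* The criterion asks for a topology on the index set; any one will do. *)
  pose ix : Type := ('I_(width N l) * C0 (layer_domain Omega Sigma l))%type.
  pose X : topologicalType := initial_topology (cst 0 : ix -> R).
  by apply/(@pointwise_cvgP X R) => -[n f]; exact: mm.
suff : \forall i \near F, W (m_ i) by apply: filterS => i; exact: WJ.
move: mW; rewrite nbhsE => -[B [[A oA <-] mA] BW].
have : nbhs (weak_star_eval m : {ptws _ -> R}) A by apply: open_nbhs_nbhs.
by move=> /ev FA; exact: (@filterS _ F _ _ _ (fun i Ai => BW _ Ai) FA).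
Qed.

End weak_star_lsc.
(** * Existence of minimisers *)

Section network_limit.
Context {R : realType} {d : nat}.
Local Notation V := 'rV[R]_d.
Local Notation leb := (@lebesgue_rV R d).
Variables (Omega Sigma : set V).
Hypotheses (oO : open Omega) (bO : bounded_set Omega).
Hypotheses (oS : open Sigma) (bS : bounded_set Sigma).
Variables (K : nat) (N : nat -> nat).
Variable E : forall i : 'I_K.+1, {set 'I_(width N i.+1) * 'I_(width N i)}.

Lemma layer_domain_open l : open (layer_domain Omega Sigma l).
Proof. by elim: l => //= l IH; exact: minkowski_sub_open. Qed.

Lemma layer_domain_bounded l : bounded_set (layer_domain Omega Sigma l).
Proof. by elim: l => //= l IH; exact: minkowski_sub_bounded. Qed.

Lemma Lp2_sum (w : set V) (T : Type) (r : seq T) (P : pred T) (h : T -> V -> R)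
    (phi : C0 w) : open w -> bounded_set w -> (forall t, Lp w 2%:E (h t)) ->
  Lp w 2%:E (\sum_(t <- r | P t) h t) /\
  \int[leb]_(x in w) ((\sum_(t <- r | P t) h t) x * phi x) =
    \sum_(t <- r | P t) \int[leb]_(x in w) (h t x * phi x).
Proof.
move=> ow bw hw.
have q1 : 1 < 2 :> R by rewrite ltr1n.
have mw := open_measurable_rV ow.
elim: r => [|t r [IH1 IH2]].
  rewrite !big_nil; split; first exact: (@Lp2_of_L2 R d w 0).
  under eq_Rintegral => x _ do rewrite [X in X * _](_ : _ = 0)// mul0r.
  by rewrite Rintegral_cst// mul0r.
rewrite !big_cons; case: ifP => // Pt.
have [g gE] := L2_of (hw t); have [g' gE'] := L2_of IH1.
split; first by rewrite -gE -gE'; exact: (@Lp2_of_L2 R d w (g + g')).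
rewrite -IH2 -RintegralD//; last 2 first.
- exact: Lp_C0_integrable q1 (hw t).
- exact: Lp_C0_integrable q1 IH1.
by apply: eq_Rintegral => x _; rewrite -mulrDl.
Qed.

Lemma layer_conv_Lp (i : 'I_K.+1) (m : measures Omega Sigma N i.+1)
    (theta : weights Sigma E) k :
  Lp (layer_domain Omega Sigma i) 2%:E (layer_conv m theta k).
Proof.
apply: (Lp2_sum _ _ (0 : C0 _) _ _ _).1.
- exact: layer_domain_open.
- exact: layer_domain_bounded.
- by move=> e; apply: conv_Lp => //; [exact: layer_domain_open|exact: layer_domain_bounded].
Qed.

Lemma layer_conv_pairing (i : 'I_K.+1) (m : measures Omega Sigma N i.+1)
    (theta : weights Sigma E) k (phi : C0 (layer_domain Omega Sigma i)) :
  \int[leb]_(x in layer_domain Omega Sigma i) (layer_conv m theta k x * phi x) =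
  \sum_(e : {e : 'I_(width N i.+1) * 'I_(width N i) | e \in E i} | (val e).2 == k)
    radon_fun (m (val e).1) (corrC0 phi (theta (existT _ i e))).
Proof.
have ol := @layer_domain_open i; have bl := layer_domain_bounded i.
rewrite (Lp2_sum _ _ phi ol bl _).2; last by move=> e; exact: conv_Lp.
by apply: eq_bigr => e _; exact: conv_pairing.
Qed.

Lemma radon_density_layer_conv (i : 'I_K.+1) (m : measures Omega Sigma N i.+1)
    (theta : weights Sigma E) k (phi : C0 (layer_domain Omega Sigma i)) :
  radon_density (layer_domain Omega Sigma i) (layer_conv m theta k) phi =
  \sum_(e : {e : 'I_(width N i.+1) * 'I_(width N i) | e \in E i} | (val e).2 == k)
    radon_fun (m (val e).1) (corrC0 phi (theta (existT _ i e))).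
Proof.
have ol := @layer_domain_open i.
rewrite radon_densityE ?layer_conv_pairing//; first exact: open_measurable_rV.
apply: (Lp_integrable ol (layer_domain_bounded i) _ (layer_conv_Lp m theta k)).
by rewrite ltr1n.
Qed.

Section limit.
Variables (I : Type) (F : set_system I) (FF : ProperFilter F).
Variables (theta_ : I -> weights Sigma E) (theta : weights Sigma E).
Hypothesis theta_bnd : forall i e, ipnorm (@ip2 R d Sigma) (theta_ i e) <= 1.
Hypothesis theta_cvg : forall e z, ip2 (theta_ i e) z @[i --> F] --> ip2 (theta e) z.

Lemma layer_conv_cvg (l : 'I_K.+1) (m_ : I -> measures Omega Sigma N l.+1)
    (m : measures Omega Sigma N l.+1) (B : R) k
    (phi : C0 (layer_domain Omega Sigma l)) :
  (forall i n, tvnorm (m_ i n) <= B%:E)%E ->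
  (forall n f, m_ i n f @[i --> F] --> m n f) ->
  radon_density (layer_domain Omega Sigma l) (layer_conv (m_ i) (theta_ i) k) phi
    @[i --> F] -->
  radon_density (layer_domain Omega Sigma l) (layer_conv m theta k) phi.
Proof.
move=> mB mm; rewrite radon_density_layer_conv.
under eq_fun do rewrite radon_density_layer_conv.
apply: cvg_big => [|e _]; first exact: add_continuous.
apply: (@conv_cvg R d (layer_domain Omega Sigma l) Sigma _ oS bS I F FF
  (fun i => theta_ i (existT _ l e)) (theta (existT _ l e)) 1 _ _
  (fun i => m_ i (val e).1) (m (val e).1) B phi).
- exact: layer_domain_bounded.
- by move=> i; exact: theta_bnd.
- by move=> z; exact: theta_cvg.
- by move=> i; exact: mB.
- by move=> f; exact: mm.
Qed.

End limit.

(** Tested against [C_0 Omega], the almost everywhere constraint becomes a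
    family of equations which are continuous for the weak convergence. *)
Lemma feasible_imageP (q : R) (v : V -> R) (m : measures Omega Sigma N 1)
    (theta : weights Sigma E) : 1 < q -> Lp Omega q%:E v ->
  {ae leb, forall x, Omega x -> v x = layer_conv (i := ord0) m theta ord0 x} <->
  forall phi : C0 Omega, \int[leb]_(x in Omega) (v x * phi x) =
    radon_density Omega (layer_conv (i := ord0) m theta ord0) phi.
Proof.
move=> q1 vq.
have mO := open_measurable_rV oO.
have q2 : 1 < 2 :> R by rewrite ltr1n.
have lc : Lp Omega 2%:E (layer_conv (i := ord0) m theta ord0).
  exact: (@layer_conv_Lp ord0).
have li := Lp_integrable oO bO q2 lc.
have vi := Lp_integrable oO bO q1 vq.
have vphi (phi : C0 Omega) := Lp_C0_integrable oO bO phi q1 vq.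
have lphi (phi : C0 Omega) := Lp_C0_integrable oO bO phi q2 lc.
split=> [ae phi|test].
  rewrite radon_densityE// /Rintegral; congr fine; apply: ae_eq_integral => //.
  - by have /integrableP[] := vphi phi.
  - by have /integrableP[] := lphi phi.
  - case: ae => M [mM M0 subM]; exists M; split=> // x nE; apply: subM => /= vx.
    by apply: nE => Ox; rewrite /= vx.
have ae : {ae leb, forall x, Omega x -> v x - layer_conv (i := ord0) m theta ord0 x = 0}.
  apply: (fundamental_lemma oO bO); first exact: (integrableB mO vi li).
  move=> phi phiO; pose phi0 : C0 Omega := exist _ phi (mem_set (C_c_C_0 phiO)).
  under eq_Rintegral do rewrite mulrBl.
  rewrite RintegralB//; [|exact: (vphi phi0)|exact: (lphi phi0)].
  by have := test phi0; rewrite radon_densityE// => ->; rewrite subrr.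
case: ae => M [mM M0 subM]; exists M; split=> // x nE; apply: subM => /= vx.
by apply: nE => Ox; have /eqP := vx Ox; rewrite subr_eq0 => /eqP.
Qed.

(** By completeness a bounded functional of the weights is an inner product
    with a fixed weight, so it is continuous for the weak convergence. *)
Lemma weights_functional_cvg Nc (Z : {linear weights Sigma E -> 'rV[R]_Nc}) (C : R)
    (I : Type) (F : set_system I) (theta_ : I -> weights Sigma E)
    (theta : weights Sigma E) j :
  (forall theta : weights Sigma E,
     (`|Z theta|%:E <= C%:E * \sum_(e : edge E) L2norm (theta e))%E) ->
  (forall z, ipsum (theta_ i) z @[i --> F] --> ipsum theta z) ->
  Z (theta_ i) ord0 j @[i --> F] --> Z theta ord0 j.
Proof.
move=> ZC tt.
have [|||h hP] := @riesz_along R (weights Sigma E) _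
    (@ipsum_semi_inner R d (edge E) Sigma) (weights Sigma E) id
    (fun t => Z t ord0 j) (`|C| * #|{: edge E}|%:R)
    (@ipsum_complete R d (edge E) Sigma).
- by [].
- by move=> a t u; rewrite linearP !mxE.
- move=> t; apply: (@le_trans _ _ `|Z t|).
    rewrite [leRHS]/Num.norm/= mx_normrE.
    exact: (le_bigmax _ (fun ij => `|Z t ij.1 ij.2|) (ord0, j)).
  rewrite -lee_fin (le_trans (ZC t))//.
  under eq_bigr do rewrite L2normE.
  rewrite sumEFin -EFinM lee_fin.
  rewrite (@le_trans _ _ (`|C| * \sum_(e : edge E) ipnorm (@ip2 R d Sigma) (t e)))//.
    by rewrite ler_wpM2r ?ler_norm// sumr_ge0// => e _; exact: ipnorm_ge0.
  rewrite -mulrA ler_wpM2l// mulr_natl -sumr_const; apply: ler_sum => e _.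
  by apply: ler_wsqrtr; exact: le_ip2_ipsum.
rewrite hP; under eq_fun do rewrite hP !(ipC (@ipsum_semi_inner R d (edge E) Sigma) h).
by rewrite (ipC (@ipsum_semi_inner R d (edge E) Sigma) h); exact: tt.
Qed.

End network_limit.
Theorem lemma2p6 (R : realType) (d : nat) (Omega Sigma : set 'rV[R]_d)
  (hOmega : bounded_domain Omega) (hSigma : bounded_domain Sigma)
  (hSigma0 : Sigma 0)
  (K : nat) (N : nat -> nat)
  (E : forall i : 'I_K.+1, {set 'I_(width N i.+1) * 'I_(width N i)})
  (hE : forall (i : 'I_K.+1) (n : 'I_(width N i.+1)),
     exists k : 'I_(width N i), (n, k) \in E i)
  (Nc : nat) (Z : {linear weights Sigma E -> 'rV[R]_Nc})
  (hZ : exists C : R, forall theta : weights Sigma E,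
     (`|Z theta|%:E <= C%:E * \sum_(e : edge E) L2norm (theta e))%E)
  (J : forall j : 'I_K, measures Omega Sigma N j.+1 -> \bar R)
  (hJ_ge0 : forall (j : 'I_K) (m : measures Omega Sigma N j.+1), (0 <= J j m)%E)
  (hJ_lsc : forall j : 'I_K, weak_star_lsc (J j))
  (hJ0 : forall j : 'I_K, J j (fun=> 0) = 0%E)
  (q : R) (hq : 1 < q <= 2)
  (v : 'rV[R]_d -> R) (hv : Lp Omega q%:E v)
  (hfin : (generative_prior J Z v < +oo)%E) :
  exists p : all_measures Omega Sigma K N * weights Sigma E,
    feasible Z v p /\ generative_prior J Z v = objective J p.1 p.2.
Proof.
have [bO oO _] := hOmega; have [bS oS _] := hSigma; have [q1 _] := andP hq.
set gp := generative_prior J Z v in hfin *.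
have sum_ge0 (mu : all_measures Omega Sigma K N) :
    (0 <= \sum_(i < K.+1) \sum_(n < width N i.+1) tvnorm (mu i n))%E.
  by apply: sume_ge0 => i _; apply: sume_ge0 => n _; exact: tvnorm_ge0.
have J_ge0 (mu : all_measures Omega Sigma K N) (theta : weights Sigma E) :
    (0 <= \sum_(j < K) J j (fun k => (mu (widen_ord (leqnSn K) j) k -
     radon_density (layer_domain Omega Sigma j.+1)
       (layer_conv (mu (lift ord0 j)) theta k))%R))%E.
  by apply: sume_ge0 => j _; exact: hJ_ge0.
have gp_ge0 : (0 <= gp)%E.
  by apply: le_ereal_inf_tmp => _ [p _ <-]; exact: adde_ge0.
have gp_fin : gp \is a fin_num by rewrite ge0_fin_numE.
have minimizing k : exists p : all_measures Omega Sigma K N * weights Sigma E,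
    feasible Z v p /\ (objective J p.1 p.2 < gp + k.+1%:R^-1%:E)%E.
  have k0 : 0 < k.+1%:R^-1 :> R by rewrite invr_gt0.
  by have [_ [p fp <-] ?] := lb_ereal_inf_adherent k0 gp_fin; exists p.
pose p_ k := projT1 (cid (minimizing k)).
have p_P k : feasible Z v (p_ k) /\
    (objective J (p_ k).1 (p_ k).2 < gp + k.+1%:R^-1%:E)%E.
  by rewrite /p_; case: cid.
have [U [UU cofU]] :=
  ultraFilterLemma (eventually_filter : ProperFilter (\oo : set_system nat)).
pose B := fine gp + 1.
have muB k i n : (tvnorm ((p_ k).1 i n) <= B%:E)%E.
  apply: (@le_trans _ _ (objective J (p_ k).1 (p_ k).2)).
    rewrite /objective (le_trans _ (leeDl _ (J_ge0 _ _)))//.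
    rewrite (bigD1 i)//= (bigD1 n)//= -addeA leeDl// adde_ge0//.
      by apply: sume_ge0 => m _; exact: tvnorm_ge0.
    by apply: sume_ge0 => l _; apply: sume_ge0 => m _; exact: tvnorm_ge0.
  rewrite (le_trans (ltW (p_P k).2))// /B EFinD fineK// leeD2l// lee_fin.
  by rewrite invf_le1// ler1n.
have thetaB k e : ipnorm (@ip2 R d Sigma) ((p_ k).2 e) <= 1.
  by have [[_ /(_ e)]] := p_P k; rewrite L2normE lee_fin.
have muU i n := weak_star_compactness UU (fun k => muB k i n).
pose mu : all_measures Omega Sigma K N := fun i n => projT1 (cid (muU i n)).
have mu_cvg (i : 'I_K.+1) (n : 'I_(width N i.+1)) (f : C0 (layer_domain Omega Sigma i.+1)) :
    (p_ k).1 i n f @[k --> U] --> mu i n f.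
  by rewrite /mu; case: cid => /= m; exact.
have [theta theta_cvg] : exists theta : weights Sigma E,
    forall z, ipsum (p_ k).2 z @[k --> U] --> ipsum theta z.
  apply: (@weak_compactness R (weights Sigma E) _ nat U (fun k => (p_ k).2)
    (Num.sqrt #|{: edge E}|%:R)).
  - exact: ipsum_semi_inner.
  - exact: ipsum_complete.
  apply: nearW => k; apply: ler_wsqrtr; rewrite -sumr_const; apply: ler_sum => e _.
  by rewrite -(ipnorm_sq (@ip2_semi_inner R d Sigma)) expr_le1// ipnorm_ge0.
have theta_cvg1 e z : ip2 ((p_ k).2 e) z @[k --> U] --> ip2 (theta e) z.
  (* A weight supported on a single edge isolates the corresponding component. *)
  pose z' : weights Sigma E := fun e' => if e' == e then z else 0.
  have z'E (t : weights Sigma E) : ipsum t z' = ip2 (t e) z.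
    rewrite /ipsum (bigD1 e)//= big1 ?addr0 /z' ?eqxx// => e' /negbTE ->.
    by rewrite (ipC (@ip2_semi_inner R d Sigma)) (ip0l (@ip2_semi_inner R d Sigma)).
  by rewrite -z'E; under eq_fun do rewrite -z'E; exact: theta_cvg.
have theta_le1 e : ipnorm (@ip2 R d Sigma) (theta e) <= 1.
  (* Pass to the limit in the Cauchy-Schwarz inequality against the limit. *)
  have h : ip2 (theta e) (theta e) <= ipnorm (@ip2 R d Sigma) (theta e).
    apply: cvgr_to_le (theta_cvg1 e (theta e)) _; apply: nearW => k.
    rewrite (le_trans (ler_norm _))//.
    rewrite (le_trans (ip_cauchy_schwarz (@ip2_semi_inner R d Sigma) _ _))//.
    by rewrite ler_piMl// ipnorm_ge0.
  move: h; rewrite -(ipnorm_sq (@ip2_semi_inner R d Sigma)).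
  have := ipnorm_ge0 (@ip2 R d Sigma) (theta e); set t := ipnorm _ _ => t0.
  rewrite leNgt => t2; rewrite leNgt; apply: contra t2 => t1.
  by rewrite expr2 ltr_pMr// (lt_trans ltr01).
have density_cvg (i : 'I_K.+1) k (phi : C0 (layer_domain Omega Sigma i)) :
    radon_density (layer_domain Omega Sigma i) (layer_conv ((p_ n).1 i) (p_ n).2 k) phi
      @[n --> U] -->
    radon_density (layer_domain Omega Sigma i) (layer_conv (mu i) theta k) phi.
  by apply: (@layer_conv_cvg R d Omega Sigma oO bO oS bS K N E nat U _
    (fun n => (p_ n).2) theta _ theta_cvg1 i (fun n => (p_ n).1 i) (mu i) B).
have feas : feasible Z v (mu, theta).
  split=> /=.
  - apply/(feasible_imageP oO bO oS bS _ _ q1 hv) => phi.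
    have := density_cvg ord0 ord0 phi.
    have -> : (fun n => radon_density (layer_domain Omega Sigma 0)
        (layer_conv ((p_ n).1 ord0) (p_ n).2 ord0) phi) =
        cst (\int[@lebesgue_rV R d]_(x in Omega) (v x * phi x)).
      apply/funext => n; have [[ae _ _] _] := p_P n.
      by have /(feasible_imageP oO bO oS bS _ _ q1 hv) -> := ae.
    by move=> lim; exact: cvg_unique (cvg_cst _) lim.
  - by move=> e; rewrite L2normE lee_fin.
  - apply/rowP => j; rewrite mxE; have [C ZC] := hZ.
    have := weights_functional_cvg (j := j) ZC theta_cvg.
    have -> : (fun n => Z (p_ n).2 ord0 j) = cst 0.
      by apply/funext => n; have [[_ _ ->] _] := p_P n; rewrite mxE.
    by move=> lim; apply/esym; exact: cvg_unique (cvg_cst _) lim.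
have obj_lsc :
    lsc_along U (fun k => objective J (p_ k).1 (p_ k).2) (objective J mu theta).
  apply: lsc_alongD => //.
    apply: lsc_along_sum => i; first by apply: sume_ge0 => n _; exact: tvnorm_ge0.
    apply: lsc_along_sum => n; first exact: tvnorm_ge0.
    by apply: tvnorm_lsc; exact: mu_cvg.
  apply: lsc_along_sum => j; first exact: hJ_ge0.
  apply: weak_star_lsc_along; first exact: hJ_lsc.
  move=> n f; rewrite radonBE; under eq_fun do rewrite radonBE.
  apply: cvgB; first exact: (mu_cvg (widen_ord (leqnSn K) j) n f).
  exact: (density_cvg (lift ord0 j) n f).
exists (mu, theta); split=> //=; apply/le_anti/andP; split.
  by apply: ereal_inf_lbound; exists (mu, theta).
rewrite leNgt; apply/negP => gp_lt.
have [r gr ro] : exists2 r : R, fine gp < r & (r%:E < objective J mu theta)%E.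
  move: gp_lt; rewrite -(fineK gp_fin); case: (objective J mu theta) => [x| |]//.
    rewrite lte_fin => gx.
    by exists ((fine gp + x) / 2); [rewrite midf_lt|rewrite lte_fin midf_lt].
  by move=> _; exists (fine gp + 1); rewrite ?ltrDl ?ltry.
have [n0 n0r] : exists n0, n0.+1%:R^-1 < r - fine gp.
  have rg : 0 < r - fine gp by rewrite subr_gt0.
  by have [n0] := ltr_add_invr rg; rewrite add0r => h; exists n0.
have late : U [set k | (n0 <= k)%N] by apply: cofU; exists n0.
have [k [/= rk n0k]] := filter_ex (filterI (obj_lsc r ro) late).
have := lt_trans rk (p_P k).2.
rewrite -(fineK gp_fin) -EFinD lte_fin ltNge; apply/negP; rewrite negbK -lerBrDl.
by rewrite (le_trans _ (ltW n0r))// lef_pV2 ?posrE// ler_nat.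
Qed.
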